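(* Let $\mathcal{H},\mathcal{K}$ be complex separable Hilbert spaces, let $(\alpha_t)_{t\ge 0}$ be an $E_0$-semigroup on $\mathcal{B}(\mathcal{H}\otimes\mathcal{K})$ and let $(\gamma_t)_{t\ge 0}$ be an $E_0$-semigroup on $\mathcal{B}(\mathcal{K})$. The following are equivalent: (i) The decomposition $\mathcal{H}\otimes\mathcal{K}$ is of Beurling type with respect to $(\alpha_t)$, such that $\mathbf{1}\otimes\gamma_t(y)=\alpha_t(\mathbf{1}\otimes y)$ for all $t\ge 0$, $y\in\mathcal{B}(\mathcal{K})$. (ii) There exists an $(\mathrm{Id}\otimes\gamma_t)$-cocycle $(u_t)_{t\ge 0}$ on $\mathcal{H}\otimes\mathcal{K}$ which is adapted and exact with respect to $\mathcal{K}$, such that $\alpha_t(x)=u_t\,(\mathrm{Id}\otimes\gamma_t)(x)\,u_t^*$ for all $t\ge 0$ and $x\in\mathcal{B}(\mathcal{H}\otimes\mathcal{K})$.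
   Context: An $E_0$-semigroup on $\mathcal{B}(\mathcal{L})$ ($\mathcal{L}$ a complex separable Hilbert space) is a pointwise weak$^*$-continuous one-parameter semigroup $(\beta_t)_{t\ge0}$ (with $\beta_0$ the identity) of normal unital $*$-endomorphisms of $\mathcal{B}(\mathcal{L})$. Two $E_0$-semigroups $(\beta_t)$ on $\mathcal{B}(\mathcal{L})$ and $(\beta'_t)$ on $\mathcal{B}(\mathcal{L}')$ are conjugate if there is a unitary $w:\mathcal{L}\to\mathcal{L}'$ with $\beta_t(x)=w^*\beta'_t(wxw^* )w$ for all $t\ge0$, $x\in\mathcal{B}(\mathcal{L})$. Beurling type: The decomposition $\mathcal{H}\otimes\mathcal{K}$ is of Beurling type with respect to $(\alpha_t)$ if $\mathbf{1}\otimes\mathcal{B}(\mathcal{K})$ is invariant for $(\alpha_t)$ and the $E_0$-semigroup $(\gamma_t)$ on $\mathcal{B}(\mathcal{K})$ determined by $\mathbf{1}\otimes\gamma_t(y)=\alpha_t(\mathbf{1}\otimes y)$ ($t\ge0$, $y\in\mathcal{B}(\mathcal{K})$) is conjugate to $(\alpha_t)$. $(\mathrm{Id}\otimes\gamma_t)_{t\ge0}$, with $\mathrm{Id}$ the identity map of $\mathcal{B}(\mathcal{H})$, is the amplification of $(\gamma_t)$, an $E_0$-semigroup on $\mathcal{B}(\mathcal{H}\otimes\mathcal{K})$. For an $E_0$-semigroup $(\beta_t)$ on $\mathcal{B}(\mathcal{L})$, a $(\beta_t)$-cocycle is a strongly continuous family $(u_t)_{t\ge0}$ of unitaries on $\mathcal{L}$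 with $u_0=\mathbf{1}$ and $u_{t+s}=u_t\beta_t(u_s)$ for all $s,t\ge0$. Fix a unit vector $\delta\in\mathcal{H}$ and identify $\mathcal{K}\simeq\delta\otimes\mathcal{K}\subset\mathcal{H}\otimes\mathcal{K}$; the orthogonal projection onto $\mathcal{K}$ is $q=|\delta\rangle\langle\delta|\otimes\mathbf{1}$. An $(\mathrm{Id}\otimes\gamma_t)$-cocycle $(u_t)$ is adapted if $u_t$ commutes with $\mathbf{1}\otimes\gamma_t(\mathcal{B}(\mathcal{K}))$ for all $t\ge0$. It is exact with respect to $\mathcal{K}$ if there is an isometry $\hat w\in\mathcal{B}(\mathcal{H}\otimes\mathcal{K})$ onto $\mathcal{K}$ (i.e. $\hat w^*\hat w=\mathbf{1}$, $\hat w\hat w^*=q$) such that $u_t=\hat w^*\,(\mathrm{Id}\otimes\gamma_t)(\hat w)$ for all $t\ge0$. (Exactness does not depend on the choice of $\delta$.) *)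

(* Defs.v *)
From HB Require Import structures.
From mathcomp Require Import all_boot all_order all_algebra.
From mathcomp Require Import all_classical all_reals all_analysis.
From mathcomp Require Export complex.
From mathcomp Require Import ring.

Set Implicit Arguments.
Unset Strict Implicit.
Unset Printing Implicit Defensive.

Import Order.TTheory GRing.Theory Num.Theory.
Import numFieldNormedType.Exports.

Local Open Scope classical_set_scope.
Local Open Scope complex_scope.
Local Open Scope ring_scope.

(** Complex Hilbert spaces. The inner product [inner] is MathComp's [{dot _ for _}]:
    linear in its first argument, conjugate-linear in its second one. *)
HB.mixin Record CompleteNormedModule_isHilbert (R : realType) H
    of CompleteNormedModule R[i] H := {
  inner : {dot H for Num.conj};
  inner_norm : forall v : H, inner v v = `|v| ^+ 2
}.

#[short(type="hilbertType")]
HB.structure Definition Hilbert (R : realType) :=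
  {H of CompleteNormedModule R[i] H & CompleteNormedModule_isHilbert R H}.

Definition separable (T : topologicalType) : Prop :=
  exists2 D : set T, countable D & dense D.

Section BoundedOperators.
Context {R : realType}.
Implicit Types H K L : hilbertType R.

Definition bop_pred H K : {pred H -> K} :=
  [pred f : H -> K | `[< linear f /\ continuous f >]].

Lemma bop_predP H K (f : H -> K) :
  reflect (linear f /\ continuous f) (f \in @bop_pred H K).
Proof. exact: asboolP. Qed.

Record bop H K := Bop { bop_fun :> H -> K; _ : bop_fun \in @bop_pred H K }.

HB.instance Definition _ H K := [isSub for @bop_fun H K].
HB.instance Definition _ H K := [Choice of bop H K by <:].

Lemma bop_pred_submod H K : submod_closed (@bop_pred H K).
Proof.
split=> [|a f g].
  apply/bop_predP; split=> [c u v|v]; last exact: cvg_cst.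
  rewrite -![(0 : H -> K) _]/(0 : K).
  by rewrite scaler0 add0r.
move=> /bop_predP[lf cf] /bop_predP[lg cg]; apply/bop_predP; split=> [c u v|v].
  rewrite -[LHS]/(a *: f (c *: u + v) + g (c *: u + v)) lf lg.
  rewrite -[(a *: f + g) u]/(a *: f u + g u) -[(a *: f + g) v]/(a *: f v + g v).
  by rewrite !scalerDr !scalerA [a * c]mulrC addrACA.
by apply: cvgD; [apply: (cvgZl_tmp (f := f)); exact: cf | exact: cg].
Qed.

HB.instance Definition _ H K :=
  GRing.isSubmodClosed.Build R[i] (H -> K) (@bop_pred H K)
    (@bop_pred_submod H K).
HB.instance Definition _ H K :=
  [SubChoice_isSubLmodule of bop H K by <:].

Lemma bopP H K (x : bop H K) : linear x /\ continuous x.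
Proof. by case: x => f /= /bop_predP. Qed.

Lemma bid_subproof H : (idfun : H -> H) \in @bop_pred H H.
Proof. by apply/bop_predP; split=> // v. Qed.

Definition bid H : bop H H := Bop (bid_subproof H).

Lemma bcomp_subproof H K L (x : bop K L) (y : bop H K) :
  x \o y \in @bop_pred H L.
Proof.
have [[lx cx] [ly cy]] := (bopP x, bopP y).
apply/bop_predP; split=> [a u v|v] /=; first by rewrite ly lx.
by apply: continuous_comp; [exact: cy | exact: cx].
Qed.

Definition bcomp H K L (x : bop K L) (y : bop H K) : bop H L :=
  Bop (bcomp_subproof x y).

(** The Riesz theorem provides exactly one such [y], so that the default value 0
    of [xget] is never used. *)
Definition adj H K (x : bop H K) : bop K H :=
  xget 0 [set y : bop K H | forall u v, inner (y v) u = inner v (x u)].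

Lemma inner_CauchySchwarz H (u v : H) : `|inner u v| <= `|u| * `|v|.
Proof.
have [->|v0] := eqVneq v 0; first by rewrite linear0r normr0 mulr_ge0.
rewrite -(ler_pXn2r (n := 2)) ?nnegrE ?mulr_ge0 // exprMn -!inner_norm.
set c := inner u v; set E := inner v v.
have E_gt0 : 0 < E by rewrite /E inner_norm exprn_gt0 ?normr_gt0.
have Er : E^* = E by apply/CrealP/ger0_real/ltW.
have cv : inner v u = c^* by rewrite hermC expr0 mul1r.
have := exprn_ge0 2 (normr_ge0 (E *: u - c *: v)).
rewrite -inner_norm linearBl /= !linearBr /= !linearZl_LR /= !linearZr_LR /=.
rewrite -/c -/E cv Er => h.
rewrite normCK -(ler_pM2l E_gt0) -subr_ge0; apply: le_trans h _.
rewrite le_eqVlt; apply/orP; left; apply/eqP.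
by rewrite -![_ *: (_ : R[i])]/(_ * _); ring.
Qed.

Lemma ketbra_subproof H K (d : K) (e : H) :
  (fun v : H => inner v e *: d) \in @bop_pred H K.
Proof.
apply/bop_predP; split=> [a u v|v].
  by rewrite linearPl /= scalerDl scalerA.
apply: cvgZr_tmp; apply/cvgrPdist_lt => eps eps_gt0.
near=> u; rewrite -linearBl; apply: le_lt_trans (inner_CauchySchwarz _ _) _.
have e1 : 0 < `|e| + 1 by rewrite ltr_wpDl.
apply: (@le_lt_trans _ _ (`|v - u| * (`|e| + 1))).
  by rewrite ler_wpM2l // lerDl.
rewrite -ltr_pdivlMr //; near: u.
apply: cvgr_dist_lt; first exact: cvg_id.
exact: divr_gt0.
Unshelve. all: by end_near. Qed.

Definition ketbra H K (d : K) (e : H) : bop H K :=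
  Bop (ketbra_subproof d e).

Definition unitary H K (w : bop H K) : Prop :=
  bcomp (adj w) w = bid H /\ bcomp w (adj w) = bid K.

End BoundedOperators.

Notation "x ** y" := (bcomp x y)
  (at level 40, left associativity) : ring_scope.

(** The weak* (= sigma-weak) topology of B(H), given by the functionals
    x |-> sum_n <x a_n, b_n> with (a_n), (b_n) square-summable: these are
    exactly the elements of the predual. *)
Section WeakStarTopology.
Context {R : realType}.
Implicit Types H K : hilbertType R.

Definition square_summable H (a : nat -> H) : Prop :=
  cvgn (series (fun n => `|a n| ^+ 2 : R[i]^o)).

Definition weakstar_functional H
    (ab : {a : nat -> H | square_summable a} * {b : nat -> H | square_summable b})
    (x : bop H H) : R[i]^o :=
  limn (series (fun n => inner (x (sval ab.1 n)) (sval ab.2 n) : R[i]^o)).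

Definition weakstar H : Type :=
  @initial_topology (bop H H)
    {ptws ({a : nat -> H | square_summable a} *
           {b : nat -> H | square_summable b}) -> R[i]^o}
    (fun x ab => weakstar_functional ab x).

HB.instance Definition _ H := Topological.on (weakstar H).

Definition normal H K (phi : bop H H -> bop K K) : Prop :=
  continuous (phi : weakstar H -> weakstar K).

Definition star_endo H (phi : bop H H -> bop H H) : Prop :=
  [/\ linear phi,
      forall x y, phi (x ** y) = phi x ** phi y &
      forall x, phi (adj x) = adj (phi x)].

(** Families indexed by [t >= 0] are functions on all of [R] whose values at
    negative times are irrelevant. *)
Definition E0_semigroup H (beta : R -> bop H H -> bop H H) : Prop :=
  [/\ forall t, 0 <= t ->
        [/\ star_endo (beta t), normal (beta t) & beta t (bid H) = bid H],
      forall x, beta 0 x = x,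
      forall s t x, 0 <= s -> 0 <= t -> beta (s + t) x = beta s (beta t x) &
      forall x, {within [set t : R | 0 <= t],
                  continuous (fun t => beta t x : weakstar H)}].

Definition conjugate H K (beta : R -> bop H H -> bop H H)
    (beta' : R -> bop K K -> bop K K) : Prop :=
  exists w : bop H K, unitary w /\
    forall t x, 0 <= t -> beta t x = adj w ** beta' t (w ** x ** adj w) ** w.

Definition cocycle H (beta : R -> bop H H -> bop H H) (u : R -> bop H H) : Prop :=
  [/\ forall t, 0 <= t -> unitary (u t),
      forall v, {within [set t : R | 0 <= t], continuous (fun t => u t v)},
      u 0 = bid H &
      forall s t, 0 <= s -> 0 <= t -> u (t + s) = u t ** beta t (u s)].

End WeakStarTopology.

(** [hilbert_tensor H K L]: the exhibition of [L] as the Hilbert space tensor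
    product of [H] and [K], which determines [L] up to a unique unitary
    compatible with the elementary tensors. *)
Record hilbert_tensor (R : realType) (H K L : hilbertType R) := HilbertTensor {
  tens :> H -> K -> L;
  tens_linearl : forall k, linear (tens^~ k);
  tens_linearr : forall h, linear (tens h);
  tens_inner : forall h k h' k',
    inner (tens h k) (tens h' k') = inner h h' * inner k k';
  tens_dense : dense [set v : L | exists (n : nat) (h : 'I_n -> H) (k : 'I_n -> K),
                                    v = \sum_(i < n) tens (h i) (k i)]
}.

Section Beurling.
Context {R : realType} {H K L : hilbertType R} (T : hilbert_tensor H K L).
Implicit Types (alpha : R -> bop L L -> bop L L) (gamma : R -> bop K K -> bop K K).

(** x (x) y, characterised by its values on elementary tensors (it exists, so the
    default value 0 is never used). *)
Definition tensop (x : bop H H) (y : bop K K) : bop L L :=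
  xget 0 [set z : bop L L | forall h k, z (T h k) = T (x h) (y k)].

(** Id (x) phi, for a normal *-endomorphism phi of B(K): the unique normal
    *-endomorphism of B(H (x) K) sending x (x) y to x (x) phi(y) for all x, y. *)
Definition amplification (phi : bop K K -> bop K K) : bop L L -> bop L L :=
  @xget (bop L L -> bop L L)%type idfun [set Phi |
    [/\ star_endo Phi, normal Phi &
        forall x y, Phi (tensop x y) = tensop x (phi y)]].

Definition determines alpha gamma : Prop :=
  forall t y, 0 <= t -> tensop (bid H) (gamma t y) = alpha t (tensop (bid H) y).

Definition beurling_type alpha : Prop :=
  (forall t y, 0 <= t -> exists y', alpha t (tensop (bid H) y) = tensop (bid H) y')
  /\ exists gamma, [/\ E0_semigroup gamma, determines alpha gamma
                      & conjugate gamma alpha].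

Definition adapted gamma (u : R -> bop L L) : Prop :=
  forall t y, 0 <= t ->
    u t ** tensop (bid H) (gamma t y) = tensop (bid H) (gamma t y) ** u t.

Definition exact_cocycle (delta : H) gamma (u : R -> bop L L) : Prop :=
  exists w : bop L L,
    [/\ adj w ** w = bid L,
        w ** adj w = tensop (ketbra delta delta) (bid K) &
        forall t, 0 <= t -> u t = adj w ** amplification (gamma t) w].

End Beurling.

(* Main.v *)
(** Writing [l_h : K -> L] for [k |-> h (x) k], both conditions provide a unitary
    [s : L -> K]: the adjoint of the conjugating unitary in (i), and
    [adj l_delta ** hatw] in (ii); conversely [hatw = l_delta ** s]. The map
    [h (x) k |-> gamma_t (s ** l_h) k] is a unitary from [L] onto [K], and
    conjugating [gamma_t (s ** _ ** adj s)] by it produces the amplification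
    [Phi_t = Id (x) gamma_t], which is characterised by
    [adj l_h' ** Phi_t z ** l_h = gamma_t (adj l_h' ** z ** l_h)]. It follows that
    [u_t = adj hatw ** Phi_t hatw] satisfies [u_t ** l_h = adj s ** gamma_t (s ** l_h)],
    and that [u] is a cocycle with
    [u_t ** Phi_t x ** adj u_t = adj s ** gamma_t (s ** x ** adj s) ** s]. When this
    is [alpha_t x], adaptedness of [u] says exactly that
    [alpha_t (1 (x) y) = 1 (x) gamma_t y]. *)

From HB Require Import structures.
Require Import Defs.
From mathcomp Require Import all_boot all_order all_algebra.
From mathcomp Require Import all_classical all_reals all_analysis.
From mathcomp Require Import ring.
Import Order.TTheory GRing.Theory Num.Theory.
Import numFieldNormedType.Exports.
Set Implicit Arguments.
Unset Strict Implicit.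
Unset Printing Implicit Defensive.
Local Open Scope classical_set_scope.
Local Open Scope complex_scope.
Local Open Scope ring_scope.

(** * Hilbert spaces and bounded operators *)

Section HilbertSpace.
Context {R : realType}.
Implicit Types H K X Y : hilbertType R.

Lemma innerC H (u v : H) : inner u v = (inner v u)^*%R.
Proof. by rewrite hermC expr0 mul1r. Qed.

Lemma innerZr H (u v : H) (a : R[i]) : inner u (a *: v) = a^*%R * inner u v.
Proof. by rewrite linearZr_LR. Qed.

Lemma innerZl H (u v : H) (a : R[i]) : inner (a *: u) v = a * inner u v.
Proof. by rewrite linearZl_LR. Qed.

Lemma inner_ge0 H (u : H) : 0 <= inner u u.
Proof. by rewrite inner_norm exprn_ge0. Qed.

Lemma inner_eq0 H (u : H) : inner u u = 0 -> u = 0.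
Proof. by rewrite inner_norm => /eqP; rewrite sqrf_eq0 normr_eq0 => /eqP. Qed.

Lemma inner_inj H (u v : H) : (forall x, inner x u = inner x v) -> u = v.
Proof.
move=> e; apply/eqP; rewrite -subr_eq0; apply/eqP/inner_eq0.
by rewrite linearBr /= e subrr.
Qed.

Lemma sqr_normD H (u v : H) :
  `|u + v| ^+ 2 = `|u| ^+ 2 + `|v| ^+ 2 + (inner u v + (inner u v)^*%R).
Proof.
by rewrite -!inner_norm linearDl !linearDr /= (innerC v u); ring.
Qed.

Lemma pythagoras H (u v : H) : inner u v = 0 ->
  `|u + v| ^+ 2 = `|u| ^+ 2 + `|v| ^+ 2.
Proof. by move=> uv; rewrite sqr_normD uv conjC0 !addr0. Qed.

Lemma parallelogram H (u v : H) :
  `|u - v| ^+ 2 = 2 * `|u| ^+ 2 + 2 * `|v| ^+ 2 - `|u + v| ^+ 2.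
Proof.
rewrite !sqr_normD normrN linearNr /= rmorphN /=; ring.
Qed.

Lemma cvg_innerl H I (F : set_system I) {FF : Filter F} (f : I -> H) u v :
  f @ F --> u -> (fun i => inner (f i) v : R[i]^o) @ F --> (inner u v : R[i]^o).
Proof.
move=> fu; apply/cvgrPdist_lt => eps eps_gt0.
near=> i; rewrite -linearBl; apply: le_lt_trans (inner_CauchySchwarz _ _) _.
apply: (@le_lt_trans _ _ (`|u - f i| * (`|v| + 1))).
  by rewrite ler_wpM2l // lerDl.
rewrite -ltr_pdivlMr ?ltr_wpDl //; near: i.
by apply: cvgr_dist_lt; rewrite ?divr_gt0 ?ltr_wpDl.
Unshelve. all: by end_near. Qed.

Lemma cauchy_seq_cvg H (f : nat -> H) :
  (forall eps : R[i], 0 < eps -> exists N, forall m n, (N <= m)%N -> (N <= n)%N ->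
     `|f m - f n| < eps) -> cvgn f.
Proof.
move=> fc; apply: cauchy_cvg; apply/cauchy_ballP => eps /fc[N fN].
near_simpl; near=> m n; rewrite -ball_normE /=; apply: fN.
  by near: m; exists N.
by near: n; exists N.
Unshelve. all: by end_near. Qed.

(** A positive element of [R[i]] has zero imaginary part, so this is the convergence of the harmonic
    sequence in [R]. *)
Lemma ltr0_harmonic (eps : R[i]) : 0 < eps ->
  exists N, forall n, (N <= n)%N -> (n.+1%:R^-1 : R[i]) < eps.
Proof.
move=> eps0; have er : eps = (complex.Re eps)%:C.
  by case: eps eps0 => a b /=; rewrite ltcE /= => /andP[/eqP-> _].
have re0 : 0 < complex.Re eps by rewrite er ltcR in eps0.
have /cvgrPdist_lt/(_ _ re0)[N _ hN] := @cvg_harmonic R.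
exists N => n /hN; rewrite sub0r normrN ger0_norm ?invr_ge0 //=.
by rewrite /harmonic er -ltcR fmorphV /= rmorph_nat.
Qed.

End HilbertSpace.

Section Operators.
Context {R : realType}.
Implicit Types H K X Y : hilbertType R.

Lemma bopE H K (x y : bop H K) : (forall v, x v = y v) -> x = y.
Proof. by move=> e; apply/val_inj/funext. Qed.

Lemma bopD H K (x : bop H K) u v : x (u + v) = x u + x v.
Proof. by have [+ _] := bopP x => /(_ 1 u v); rewrite !scale1r. Qed.

Lemma bop0 H K (x : bop H K) : x 0 = 0.
Proof. by apply: (addIr (x 0)); rewrite -bopD !add0r. Qed.

Lemma bopZ H K (x : bop H K) a v : x (a *: v) = a *: x v.
Proof. by have [+ _] := bopP x => /(_ a v 0); rewrite bop0 !addr0. Qed.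

Lemma bopN H K (x : bop H K) v : x (- v) = - x v.
Proof. by rewrite -scaleN1r bopZ scaleN1r. Qed.

Lemma bopB H K (x : bop H K) u v : x (u - v) = x u - x v.
Proof. by rewrite bopD bopN. Qed.

Lemma bop_sum H K (x : bop H K) I (r : seq I) (P : pred I) (f : I -> H) :
  x (\sum_(i <- r | P i) f i) = \sum_(i <- r | P i) x (f i).
Proof. exact: (big_morph x (bopD x) (bop0 x)). Qed.

Lemma bopDE H K (x y : bop H K) v : (x + y) v = x v + y v. Proof. by []. Qed.
Lemma bop0E H K v : (0 : bop H K) v = 0. Proof. by []. Qed.
Lemma bopZE H K (x : bop H K) a v : (a *: x) v = a *: x v. Proof. by []. Qed.
Lemma bopNE H K (x : bop H K) v : (- x) v = - x v. Proof. by []. Qed.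
Lemma bop_sumE H K I (r : seq I) (P : pred I) (f : I -> bop H K) v :
  (\sum_(i <- r | P i) f i) v = \sum_(i <- r | P i) f i v.
Proof.
exact: (big_morph (fun x : bop H K => x v) (fun x y => bopDE x y v) (bop0E K v)).
Qed.

Lemma bop_cvg H K (x : bop H K) I (F : set_system I) {FF : Filter F}
    (f : I -> H) (v : H) : f @ F --> v -> x (f i) @[i --> F] --> x v.
Proof. by move=> fv; apply: continuous_cvg fv; have [_] := bopP x; apply. Qed.

Lemma linear_continuous_bounded H K (f : H -> K) : linear f ->
  (continuous f <-> exists2 C : R[i], 0 < C & forall v, `|f v| <= C * `|v|).
Proof.
move=> lf; pose f' := GRing.isLinear.Build R[i] H K *:%R f lf.
pose g : {linear H -> K} := HB.pack f f'.
have -> : f = g by [].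
split=> [/linear_bounded_continuous/linear_boundedP/pinfty_ex_gt0[C C0 hC]|].
  by exists C.
move=> [C C0 hC]; apply/linear_bounded_continuous/linear_boundedP.
near=> r => v; apply: le_trans (hC v) _; rewrite ler_wpM2r //.
by near: r; apply: nbhs_pinfty_ge; rewrite gtr0_real.
Unshelve. all: by end_near. Qed.

Lemma bop_bounded H K (x : bop H K) :
  exists2 C : R[i], 0 < C & forall v, `|x v| <= C * `|v|.
Proof. by have [lx cx] := bopP x; apply/linear_continuous_bounded. Qed.

Lemma bop_exists H K (f : H -> K) (C : R[i]) : linear f ->
  (forall v, `|f v| <= C * `|v|) -> exists x : bop H K, forall v, x v = f v.
Proof.
move=> lf fC.
have fP : f \in @bop_pred R H K.
  apply/bop_predP; split=> //; apply/linear_continuous_bounded => //.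
  (* [C] may be negative when the space is zero, hence the bound [|C| + 1]. *)
  exists (`|C| + 1) => [|v]; first by rewrite ltr_wpDl.
  have [->|v0] := eqVneq v 0.
    by have := lf (-1) 0 0; rewrite scaler0 addr0 scaleN1r addNr => ->;
      rewrite !normr0 mulr0.
  have v_gt0 : 0 < `|v| by rewrite normr_gt0.
  have C0 : 0 <= C by rewrite -(pmulr_lge0 _ v_gt0) (le_trans _ (fC v)).
  by apply: le_trans (fC v) _; rewrite ler_wpM2r // ger0_norm // lerDl.
by exists (Bop fP).
Qed.

End Operators.

(** * Riesz representation and adjoints *)

Section Adjoints.
Context {R : realType}.
Implicit Types H K X Y : hilbertType R.

Lemma cvg_unique_norm (V : normedModType R[i]) I (F : set_system I)
  {FF : ProperFilter F} (f : I -> V) (a b : V) : f @ F --> a -> f @ F --> b -> a = b.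
Proof. exact: norm_cvg_unique. Qed.

(** Nonnegative elements of [R[i]] are real, so [D] is the infimum in [R] of the real parts. *)
Lemma complex_inf (A : set R[i]) : A !=set0 -> (forall a, A a -> 0 <= a) ->
  exists D : R[i], (forall a, A a -> D <= a) /\
    (forall eps, 0 < eps -> exists2 a, A a & a < D + eps).
Proof.
move=> [a0 Aa0] A0.
have AR a : A a -> a = (complex.Re a)%:C.
  by move=> /A0; case: a => x y; rewrite lecE /= => /andP[/eqP-> _].
pose B := [set complex.Re a | a in A].
have hB : has_inf B.
  split; first by exists (complex.Re a0), a0.
  by exists 0 => _ [a Aa <-]; have := A0 _ Aa; rewrite {1}(AR _ Aa) lecR.
exists (inf B)%:C; split=> [a Aa|eps eps0].
  by rewrite (AR _ Aa) lecR; apply: ge_inf; [case: hB | exists a].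
have er : eps = (complex.Re eps)%:C.
  by case: eps eps0 => x y; rewrite ltcE /= => /andP[/eqP-> _].
have re0 : 0 < complex.Re eps by rewrite er ltcR in eps0.
have [_ [a Aa <-] ha] := inf_adherent re0 hB.
by exists a => //; rewrite (AR _ Aa) er -rmorphD ltcR.
Qed.

(** The representing vector is found by minimising the norm on [f = 1]. *)
Theorem Riesz H (f : H -> R[i]) (C : R[i]) :
  (forall a u v, f (a *: u + v) = a * f u + f v) ->
  (forall u, `|f u| <= C * `|u|) -> exists y, forall u, f u = inner u y.
Proof.
move=> lf fC.
have [f0|/existsNP[u0 /eqP fu0]] := pselect (forall u, f u = 0).
  by exists 0 => u; rewrite f0 linear0r.
have f00 : f 0 = 0.
  by have := lf (-1) 0 0; rewrite scaler0 addr0 mulN1r addNr.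
have fD u v : f (u + v) = f u + f v by rewrite -[u]scale1r lf scale1r mul1r.
have fZ a u : f (a *: u) = a * f u by rewrite -[a *: u]addr0 lf f00 addr0.
have C0 : 0 <= C.
  have u0_gt0 : 0 < `|u0|.
    by rewrite normr_gt0; apply: contra fu0 => /eqP->; rewrite f00.
  by rewrite -(pmulr_lge0 _ u0_gt0) (le_trans _ (fC u0)).
have [||D [Dle Dinf]] := @complex_inf [set `|v| ^+ 2 | v in [set v | f v = 1]].
- by exists (`|(f u0)^-1 *: u0| ^+ 2), ((f u0)^-1 *: u0); rewrite //= fZ mulVf.
- by move=> _ [v _ <-]; rewrite exprn_ge0.
have /choice[v /all_and2[fv vD]] (n : nat) :
    exists v : H, f v = 1 /\ `|v| ^+ 2 < D + n.+1%:R^-1.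
  have [|_ [v fv <-] vn] := Dinf n.+1%:R^-1; first by rewrite invr_gt0.
  by exists v.
have v_cvg : cvgn v.
  apply: cauchy_seq_cvg => eps eps0.
  have [|N hN] := @ltr0_harmonic R (eps ^+ 2 / 4).
    by rewrite divr_gt0 ?exprn_gt0.
  exists N => m n Nm Nn.
  rewrite -(ltr_pXn2r (n := 2)) ?nnegrE ?normr_ge0 ?(ltW eps0) //.
  rewrite parallelogram.
  (* The midpoint of [v m] and [v n] also satisfies [f = 1], so its squared norm is at least [D];
     with the parallelogram law this makes [v] Cauchy. *)
  have h4 : 4 * D <= `|v m + v n| ^+ 2.
    rewrite mulrC -ler_pdivlMr //; apply: Dle.
    exists (2^-1 *: (v m + v n)) => /=.
      by rewrite fZ fD !fv -[1 + 1]/(2%:R) mulVf ?pnatr_eq0.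
    by rewrite normrZ exprMn normfV normr_nat exprVn -natrX mulrC.
  have lt_v k : (N <= k)%N -> `|v k| ^+ 2 < D + eps ^+ 2 / 4.
    by move=> /hN hk; apply: lt_trans (vD k) _; rewrite ltrD2l.
  rewrite ltrBlDr; apply: (@lt_le_trans _ _ (eps ^+ 2 + 4 * D)).
    have -> : eps ^+ 2 + 4 * D
        = 2 * (D + eps ^+ 2 / 4) + 2 * (D + eps ^+ 2 / 4) by field.
    by rewrite ltrD // ltr_pM2l ?lt_v.
  by rewrite lerD2l.
have f_cont : continuous (f : H -> R[i]^o).
  move=> u; apply/cvgrPdist_lt => e e0; near=> w.
  have -> : f u - f w = f (u - w) by rewrite -[- w]scaleN1r fD fZ mulN1r.
  apply: le_lt_trans (fC _) _.
  apply: (@le_lt_trans _ _ ((C + 1) * `|u - w|)).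
    by rewrite ler_wpM2r // lerDl.
  rewrite mulrC -ltr_pdivlMr ?ltr_wpDl //; near: w.
  by apply: cvgr_dist_lt; rewrite ?divr_gt0 ?ltr_wpDl.
set v0 := limn v.
have fv0 : f v0 = 1.
  have : (f \o v) @ \oo --> (f v0 : R[i]^o).
    exact: cvg_comp v_cvg (f_cont v0).
  rewrite (_ : f \o v = cst 1); last by apply/funext => n /=.
  by move=> h; apply: (@cvg_unique_norm R[i]^o nat \oo _ _ _ _ h); exact: cvg_cst.
have v0_orth k : f k = 0 -> inner v0 k = 0.
  move=> fk.
  have hk : (fun n => inner (v n) k : R[i]^o) @ \oo --> (inner v0 k : R[i]^o).
    exact: cvg_innerl.
  apply: (@cvg_unique_norm R[i]^o nat \oo _ _ _ _ hk); apply/cvgrPdist_lt => eps eps0.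
  (* [E] replaces [|k| ^+ 2] in the optimal coefficient, so that [k = 0] needs no separate case. *)
  set E := `|k| ^+ 2 + 1.
  have E0 : 0 < E by rewrite ltr_wpDl ?exprn_ge0.
  have [|N hN] := @ltr0_harmonic R (eps ^+ 2 / E).
    by rewrite divr_gt0 ?exprn_gt0.
  exists N => // n /= /hN hn; rewrite sub0r normrN.
  set p := inner (v n) k.
  rewrite -(ltr_pXn2r (n := 2)) ?nnegrE ?normr_ge0 ?(ltW eps0) //.
  suff le_p : `|p| ^+ 2 / E <= n.+1%:R^-1.
    by rewrite -(ltr_pM2r (x := E^-1)) ?invr_gt0 // (le_lt_trans le_p).
  have Ec : E^*%R = E by apply/CrealP/ger0_real/ltW.
  have ip : inner (v n) ((- p / E) *: k) = - (`|p| ^+ 2 / E).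
    by rewrite innerZr !rmorphM /= rmorphN fmorphV /= Ec normCK -/p; ring.
  (* The perturbed vector still satisfies [f = 1]; minimality gives [D <= |v n| ^+ 2 - |p| ^+ 2 / E
     - |p| ^+ 2 / E ^+ 2], which bounds [|p| ^+ 2 / E]. *)
  have : D <= `|v n + (- p / E) *: k| ^+ 2.
    apply: Dle; exists (v n + (- p / E) *: k) => //=.
    by rewrite fD fZ fv fk mulr0 addr0.
  rewrite sqr_normD ip rmorphN /= (CrealP _); last first.
    by rewrite ger0_real // divr_ge0 ?exprn_ge0 // ltW.
  have -> : `|(- p / E) *: k| ^+ 2 = `|p| ^+ 2 / E - `|p| ^+ 2 / E ^+ 2.
    rewrite normrZ normrM normrN normfV (gtr0_norm E0).
    have -> : (`|p| / E * `|k|) ^+ 2 = `|p| ^+ 2 / E ^+ 2 * `|k| ^+ 2.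
      by rewrite !exprMn exprVn.
    have -> : `|k| ^+ 2 = E - 1 by rewrite addrK.
    by field; rewrite gt_eqF.
  move=> le_D; rewrite -(lerD2l D).
  apply: le_trans (ltW (vD n)).
  rewrite -lerBrDr; apply: le_trans le_D _.
  set A := _ / E; set B := _ / E ^+ 2.
  have -> : `|v n| ^+ 2 + (A - B) + (- A - A) = `|v n| ^+ 2 - A - B by ring.
  by rewrite lerBlDr lerDl /B divr_ge0 ?exprn_ge0 // ltW.
have n0 : inner v0 v0 != 0.
  by apply/eqP => /inner_eq0 v00; move: fv0; rewrite v00 f00 => /esym/eqP;
    rewrite oner_eq0.
(* [u - f u *: v0] lies in the kernel of [f], hence is orthogonal to [v0]; solving for [f u] gives
   this multiple of [v0]. *)
exists ((inner v0 v0)^-1 *: v0) => u.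
have := v0_orth (u - f u *: v0); rewrite -scaleNr fD fZ fv0 mulr1 subrr.
move=> /(_ erefl) /(congr1 Num.conj); rewrite -innerC conjC0.
rewrite linearDl /= innerZl => /eqP; rewrite mulNr subr_eq0 => /eqP uv.
by rewrite innerZr uv fmorphV /= -innerC mulrC mulfK.
Unshelve. all: by end_near. Qed.

(** [y v] is the Riesz representative of [u |-> inner (x u) v]; it is bounded because [|y v| ^+ 2 =
    inner (x (y v)) v <= C * |y v| * |v|]. *)
Lemma adj_exists H K (x : bop H K) :
  exists y : bop K H, forall u v, inner (y v) u = inner v (x u).
Proof.
have [C C0 xC] := bop_bounded x.
have /choice[y yP] v : exists w, forall u, inner (x u) v = inner u w.
  apply: (@Riesz _ _ (C * `|v|)) => [a u u'|u].
    by rewrite bopD bopZ linearDl /= innerZl.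
  apply: le_trans (inner_CauchySchwarz _ _) _.
  by rewrite mulrAC ler_wpM2r.
have [|v|z zP] := @bop_exists _ K H y C.
- move=> a u v; apply: inner_inj => w.
  by rewrite -yP !linearDr /= !innerZr -!yP.
- have [->|yv0] := eqVneq (y v) 0; first by rewrite normr0 mulr_ge0 // ltW.
  rewrite -(ler_pM2r (x := `|y v|)) ?normr_gt0 //.
  rewrite -expr2 -inner_norm -yP.
  rewrite -[inner _ _]ger0_norm; last by rewrite yP inner_ge0.
  apply: le_trans (inner_CauchySchwarz _ _) _.
  by rewrite mulrAC ler_wpM2r.
- by exists z => u v; rewrite zP innerC -yP -innerC.
Qed.

Lemma adjP H K (x : bop H K) u v : inner (adj x v) u = inner v (x u).
Proof. by rewrite /adj; exact: (xgetPex 0 (adj_exists x)). Qed.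

Lemma adjE H K (x : bop H K) u v : inner u (adj x v) = inner (x u) v.
Proof. by rewrite innerC adjP -innerC. Qed.

Lemma adj_unique H K (x : bop H K) (y : bop K H) :
  (forall u v, inner (y v) u = inner v (x u)) -> adj x = y.
Proof.
by move=> e; apply: bopE => v; apply: inner_inj => u; rewrite adjE innerC -e -innerC.
Qed.

Lemma adjK H K (x : bop H K) : adj (adj x) = x.
Proof. by apply: adj_unique => u v; rewrite adjE. Qed.

Lemma adjM H K X (x : bop K X) (y : bop H K) : adj (x ** y) = adj y ** adj x.
Proof. by apply: adj_unique => u v /=; rewrite adjP adjP. Qed.

Lemma bcompA H K X Y (x : bop X Y) (y : bop K X) (z : bop H K) :
  x ** (y ** z) = x ** y ** z.
Proof. exact: bopE. Qed.

Lemma bcomp1 H K (x : bop H K) : x ** bid H = x.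
Proof. exact: bopE. Qed.

Lemma bcomp1l H K (x : bop H K) : bid K ** x = x.
Proof. exact: bopE. Qed.

Lemma isometry_norm H K (x : bop H K) : adj x ** x = bid H ->
  forall v, `|x v| = `|v|.
Proof.
move=> e v; apply/eqP; rewrite -(eqrXn2 (n := 2)) // -!inner_norm -adjP.
by rewrite -[adj x (x v)]/((adj x ** x) v) e.
Qed.

End Adjoints.

(** * Total sets and strong limits *)

Section TotalSets.
Context {R : realType}.
Implicit Types H K X Y : hilbertType R.

Definition closed_subspace H (S : set H) : Prop :=
  [/\ closed S, S 0 & forall (a : R[i]) u v, S u -> S v -> S (a *: u + v)].

(** Density of the linear span, phrased as an induction principle: a property defining a closed
    subspace holds everywhere once it holds on [E]. *)
Definition total H (E : set H) : Prop :=
  forall S, closed_subspace S -> E `<=` S -> forall v, S v.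

Lemma subspace_sum H (S : set H) (I : finType) (P : pred I) (f : I -> H) :
  closed_subspace S -> (forall i, P i -> S (f i)) -> S (\sum_(i | P i) f i).
Proof.
move=> [_ S0 SD] Sf; apply: (@big_ind _ S) => // u v Su Sv.
by rewrite -[u]scale1r; exact: SD.
Qed.

Lemma closed_approx H (S : set H) :
  (forall v, (forall eps : R[i], 0 < eps -> exists2 u, S u & `|v - u| < eps) ->
     S v) ->
  closed S.
Proof.
move=> hS v clv; apply: hS => eps eps0.
have [|u [Su]] := clv (ball v eps); first exact: nbhsx_ballx.
by rewrite -ball_normE; exists u.
Qed.

Lemma total_eq H K (E : set H) (x y : bop H K) : total E ->
  (forall v, E v -> x v = y v) -> x = y.
Proof.
move=> totE xy; apply: bopE; apply: totE => //; split=> [||a u v /= Su Sv].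
- apply: closed_approx => v hv; apply/eqP; rewrite -subr_eq0 -normr_eq0.
  have [C C0 xC] := bop_bounded (x - y).
  rewrite eq_le normr_ge0 andbT.
  apply/ler_addgt0Pr => eps eps0; rewrite add0r.
  have [|u xyu] := hv (eps / C); first by rewrite divr_gt0.
  rewrite ltr_pdivlMr // mulrC => hu; apply: ltW; apply: le_lt_trans hu.
  apply: le_trans (xC _).
  by rewrite bopDE bopNE !bopB xyu opprB addrA subrK.
- by rewrite /= !bop0.
- by rewrite !bopD !bopZ Su Sv.
Qed.

(** If [T n u] converges and [u] is near [v], then [|T n v - T n u| <= C * |v - u|] uniformly in
    [n], so [T n v] is Cauchy. *)
Lemma cvgn_closed_subspace X Y (T : nat -> bop X Y) (C : R[i]) : 0 < C ->
  (forall n v, `|T n v| <= C * `|v|) ->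
  closed_subspace [set v | cvgn (fun n => T n v)].
Proof.
move=> C0 TC; split=> [||a u v /= Su Sv].
- apply: closed_approx => v hv; apply: cauchy_seq_cvg => eps eps0.
  have e4 : 0 < eps / 4 by rewrite divr_gt0.
  have [|u Tu uv] := hv (eps / 4 / C); first by rewrite divr_gt0.
  have {}uv n : `|T n v - T n u| < eps / 4.
    rewrite -bopB; apply: le_lt_trans (TC _ _) _.
    by rewrite mulrC -ltr_pdivlMr.
  have /cvgrPdist_lt/(_ _ e4)[N _ hN] := Tu.
  exists N => m n /hN /= um /hN /= un.
  have -> : T m v - T n v = (T m v - T m u) + (T m u - limn (fun n => T n u))
     + ((limn (fun n => T n u) - T n u) + (T n u - T n v)).
    by rewrite !addrA !subrK.
  have -> : eps = (eps / 4 + eps / 4) + (eps / 4 + eps / 4) by field.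
  apply: le_lt_trans (ler_normD _ _) _; apply: ltrD;
    apply: le_lt_trans (ler_normD _ _) _; apply: ltrD => //;
    by rewrite distrC.
- rewrite /= (_ : (fun n => _) = cst 0); first exact: is_cvg_cst.
  by apply/funext => n; rewrite bop0.
- rewrite /= (_ : (fun n => _) = (fun n => a *: T n u + T n v)).
    by apply: is_cvgD => //; apply: is_cvgZr.
  by apply/funext => n; rewrite bopD bopZ.
Qed.

(** The bound is asked only near [F] with a view to cocycles, where [t] tends to [t0] within the
    nonnegative times and unitarity is known only there. *)
Lemma cvg_closed_subspace X Y I (F : set_system I) {FF : Filter F}
    (T : I -> bop X Y) (Z : bop X Y) (C : R[i]) : 0 < C ->
  (\forall i \near F, forall v, `|T i v| <= C * `|v|) ->
  closed_subspace [set v | T i v @[i --> F] --> Z v].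
Proof.
move=> C0 TC; have [D D0 ZD] := bop_bounded Z.
split=> [||a u v /= Su Sv].
- apply: closed_approx => v hv; apply/cvgrPdist_lt => eps eps0.
  have e3 : 0 < eps / 3 by rewrite divr_gt0.
  pose M := C + D.
  have M0 : 0 < M by rewrite addr_gt0.
  have [|u Tu uv] := hv (eps / 3 / M); first by rewrite divr_gt0.
  have {}uv : M * `|v - u| < eps / 3 by rewrite mulrC -ltr_pdivlMr.
  near=> i.
  have -> : Z v - T i v = (Z v - Z u) + (Z u - T i u) + (T i u - T i v).
    by rewrite !addrA !subrK.
  have -> : eps = eps / 3 + eps / 3 + eps / 3 by field.
  apply: le_lt_trans (ler_normD _ _) _; apply: ltrD.
    apply: le_lt_trans (ler_normD _ _) _; apply: ltrD.
      rewrite -bopB; apply: le_lt_trans uv; apply: le_trans (ZD _) _.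
      by rewrite ler_wpM2r // lerDr ltW.
    by near: i; move/cvgrPdist_lt: Tu; apply.
  rewrite -bopB; apply: le_lt_trans uv.
  have Ci : `|T i (u - v)| <= C * `|u - v| by near: i; apply: filterS TC.
  by apply: le_trans Ci _; rewrite distrC ler_wpM2r // lerDl ltW.
- rewrite /= (_ : (fun n => _) = cst 0); first by rewrite bop0; exact: cvg_cst.
  by apply/funext => n; rewrite bop0.
- rewrite /= (_ : (fun n => _) = (fun n => a *: T n u + T n v)).
    by rewrite bopD bopZ; apply: cvgD => //; apply: cvgZl_tmp.
  by apply/funext => n; rewrite bopD bopZ.
Unshelve. all: by end_near. Qed.

(** The points of convergence form a closed subspace containing [E]; the pointwise limit inherits
    linearity and the bound [C]. *)
Lemma strong_limit X Y (E : set X) (T : nat -> bop X Y) (C : R[i]) : 0 < C ->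
  total E -> (forall n v, `|T n v| <= C * `|v|) ->
  (forall v, E v -> cvgn (fun n => T n v)) ->
  exists Z : bop X Y, forall v, T n v @[n --> \oo] --> Z v.
Proof.
move=> C0 totE TC TE.
have Tcvg := totE _ (cvgn_closed_subspace C0 TC) TE.
have [|v|Z ZP] := @bop_exists _ X Y (fun v => limn (fun n => T n v)) C.
- move=> a u v; apply: cvg_lim; first exact: norm_hausdorff.
  rewrite (_ : (fun n => _) = (fun n => a *: T n u + T n v)).
    by apply: cvgD; [apply: cvgZl_tmp|]; exact: Tcvg.
  by apply/funext => n; rewrite bopD bopZ.
- apply/ler_addgt0Pr => eps eps0.
  have /cvgrPdist_lt/(_ _ eps0)[N _ /(_ N (leqnn N)) /= hN] := Tcvg v.
  rewrite -[limn _](subrK (T N v)) addrC.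
  by apply: le_trans (ler_normD _ _) _; rewrite lerD // ltW.
- by exists Z => v; rewrite ZP; exact: Tcvg.
Qed.

End TotalSets.

(** * Orthonormal bases and tensor products *)

Section OrthonormalBases.
Context {R : realType}.
Implicit Types H K X Y : hilbertType R.

(** Zero vectors are allowed, so that finite-dimensional spaces need no separate
    treatment. *)
Definition orthobasis H (e : nat -> H) : Prop :=
  [/\ forall m n, m != n -> inner (e m) (e n) = 0,
      forall n, e n = 0 \/ inner (e n) (e n) = 1 &
      total (range e)].

Lemma dense_total H (D : set H) : dense D -> total D.
Proof.
move=> denseD S [closedS _ _] DS v; apply: closedS => A.
rewrite nbhsE => -[B [openB Bv] BA].
have [|w [Bw Dw]] := denseD B _ openB; first by exists v.
by exists w; split; [exact: DS | exact: BA].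
Qed.

(** Gram-Schmidt along an enumeration of a countable dense set; a vector already in the span of its
    predecessors yields [e n = 0]. *)
Lemma orthobasis_exists H : separable H -> exists e : nat -> H, orthobasis e.
Proof.
move=> [D cD dD].
have /countable_injP[f f_inj] := cD.
(* [f] codes [D] injectively by naturals; [d] decodes, with value 0 at numbers that code nothing. *)
pose d n : H := xget 0 [set v | D v /\ f v = n].
have dE v : D v -> d (f v) = v.
  move=> Dv; rewrite /d; case: xgetP => [w _ [Dw fw]|/(_ v)[]//].
  by apply: f_inj; rewrite ?inE.
pose nrm (v : H) := `|v|^-1 *: v.
pose g (E : nat -> H) n := d n - \sum_(i < n) inner (d n) (E i) *: E i.
(* [E n] tabulates the first [n] vectors, which makes the course-of-values recursion structural; [e]
   is the diagonal. *)
pose fix E n : nat -> H :=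
  if n is n'.+1 then fun k => if k == n' then nrm (g (E n') n') else E n' k
  else fun=> 0.
pose e k := E k.+1 k.
have Ee n k : (k < n)%N -> E n k = e k.
  elim: n => // n IHn; rewrite ltnS leq_eqVlt => /predU1P[->//|kn] /=.
  by rewrite ltn_eqF // IHn.
have gE n : g (E n) n = g e n.
  by rewrite /g; congr (_ - _); apply: eq_bigr => i _; rewrite Ee.
have eE n : e n = nrm (g e n) by rewrite -gE /e /= eqxx.
have e01 n : e n = 0 \/ inner (e n) (e n) = 1.
  rewrite eE /nrm; have [->|g0] := eqVneq (g e n) 0.
    by left; rewrite scaler0.
  right; rewrite inner_norm normrZ normfV normr_id mulVf ?expr1n //.
  by rewrite normr_eq0.
have orth n m : (m < n)%N -> inner (e n) (e m) = 0.
  elim/ltn_ind: n m => n IHn m mn.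
  have e_orth i j : (i < n)%N -> (j < n)%N -> i != j -> inner (e i) (e j) = 0.
    move=> ltin ltjn; rewrite neq_ltn => /orP[ij|ji].
      by rewrite innerC IHn // conjC0.
    exact: IHn.
  rewrite eE /nrm innerZl; suff -> : inner (g e n) (e m) = 0 by rewrite mulr0.
  rewrite /g linearBl /= linear_sumlz /=.
  rewrite (bigD1 (Ordinal mn)) //= big1 => [|i im]; last first.
    by rewrite innerZl e_orth ?mulr0.
  rewrite innerZl addr0; have [->|->] := e01 m.
    by rewrite !linear0r subrr.
  by rewrite mulr1 subrr.
exists e; split=> // [m n|].
  rewrite neq_ltn => /orP[mn|nm]; last exact: orth.
  by rewrite innerC orth // conjC0.
move=> S clS eS; apply: (dense_total dD) => // v /dE <-.
move: (f v) => n; have [_ S0 SD] := clS.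
have -> : d n = `|g e n| *: e n + \sum_(i < n) inner (d n) (e i) *: e i.
  rewrite eE /nrm scalerA; have [g0|g0] := eqVneq (g e n) 0.
    by rewrite g0 scaler0 add0r; apply/eqP; rewrite -subr_eq0 -[_ - _]/(g e n) g0.
  by rewrite mulfV ?normr_eq0 // scale1r /g subrK.
apply: (SD); first by apply: eS; exists n.
apply: subspace_sum => // i _; rewrite -[_ *: _]addr0; apply: SD => //.
by apply: eS; exists (i : nat).
Qed.

Lemma norm_sum_orthogonal X (f : nat -> X) N :
  (forall m n, m != n -> inner (f m) (f n) = 0) ->
  `|\sum_(n < N) f n| ^+ 2 = \sum_(n < N) `|f n| ^+ 2.
Proof.
move=> orth; elim: N => [|N IHN]; first by rewrite !big_ord0 normr0 expr0n.
rewrite !big_ord_recr /= pythagoras ?IHN // linear_sumlz /= big1 // => i _.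
by rewrite orth // ltn_eqF.
Qed.

(** For the sum [P] of the [Q n v], the hypotheses give [|P| ^+ 2 = inner P v <= |P| * |v|]. *)
Lemma Bessel X (Q : nat -> bop X X) N v :
  (forall m n, m != n -> inner (Q m v) (Q n v) = 0) ->
  (forall n, inner (Q n v) v = `|Q n v| ^+ 2) ->
  \sum_(n < N) `|Q n v| ^+ 2 <= `|v| ^+ 2.
Proof.
move=> orth Qv; set P := \sum_(n < N) Q n v.
have PE : `|P| ^+ 2 = \sum_(n < N) `|Q n v| ^+ 2.
  exact: (norm_sum_orthogonal (f := fun n => Q n v)).
have Pv : inner P v = `|P| ^+ 2.
  by rewrite PE linear_sumlz /=; apply: eq_bigr.
rewrite -PE ler_pXn2r ?nnegrE //.
have [->|P0] := eqVneq P 0; first by rewrite normr0.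
rewrite -(ler_pM2l (x := `|P|)) ?normr_gt0 // -expr2 -Pv.
apply: le_trans (inner_CauchySchwarz _ _).
by rewrite ger0_norm // Pv exprn_ge0.
Qed.

End OrthonormalBases.

(** * Slices of a tensor product and operators defined from them *)

Section Tensor.
Context {R : realType}.
Implicit Types H K L X : hilbertType R.

Lemma tens_norm H K L (T : hilbert_tensor H K L) h k : `|T h k| = `|h| * `|k|.
Proof.
apply/eqP; rewrite -(eqrXn2 (n := 2)) ?mulr_ge0 //.
by rewrite exprMn -!inner_norm tens_inner.
Qed.

Lemma slice_subproof H K L (T : hilbert_tensor H K L) h :
  T h \in @bop_pred R K L.
Proof.
apply/bop_predP; have lT := tens_linearr T h; split=> //.
apply/linear_continuous_bounded => //; exists (`|h| + 1) => [|k].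
  by rewrite ltr_wpDl.
by rewrite tens_norm ler_wpM2r // lerDl.
Qed.

Definition slice H K L (T : hilbert_tensor H K L) h : bop K L :=
  Bop (slice_subproof T h).

Lemma slice_linear H K L (T : hilbert_tensor H K L) a h h' :
  slice T (a *: h + h') = a *: slice T h + slice T h'.
Proof. by apply: bopE => k; exact: tens_linearl. Qed.

Lemma slice0 H K L (T : hilbert_tensor H K L) : slice T 0 = 0.
Proof.
by have := slice_linear T (-1) 0 0; rewrite scaler0 addr0 scaleN1r addNr.
Qed.

Lemma adj_slice H K L (T : hilbert_tensor H K L) h h' k :
  adj (slice T h) (T h' k) = inner h' h *: k.
Proof.
by apply: inner_inj => k'; rewrite adjE /= tens_inner innerZr -innerC.
Qed.

Lemma tens_total H K L (T : hilbert_tensor H K L) :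
  total [set v | exists h k, v = T h k].
Proof.
move=> S clS TS; apply: (dense_total (@tens_dense _ _ _ _ T)) => //.
move=> _ [n [h [k ->]]]; apply: subspace_sum => // i _.
by apply: TS; exists (h i), (k i).
Qed.

#[global] Arguments tens_total {H K L} T.

Lemma slice_ext H K L X (T : hilbert_tensor H K L) (x y : bop L X) :
  (forall h, x ** slice T h = y ** slice T h) -> x = y.
Proof.
move=> xy; apply: (total_eq (tens_total T)) => _ [h [k ->]].
by rewrite -[x _]/((x ** slice T h) k) xy.
Qed.

Lemma swap_dense H K L (T : hilbert_tensor H K L) :
  dense [set v : L | exists (n : nat) (k : 'I_n -> K) (h : 'I_n -> H),
                       v = \sum_(i < n) T (h i) (k i)].
Proof.
move=> A A0 oA; have [v [Av [n [h [k vE]]]]] := tens_dense T A0 oA.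
by exists v; split=> //; exists n, k, h.
Qed.

(** Exchanging the factors over the same [L] lets results on slices at [h] serve for slices at
    [k]. *)
Definition swap H K L (T : hilbert_tensor H K L) : hilbert_tensor K H L :=
  @HilbertTensor R K H L (fun k h => T h k)
    (tens_linearr T) (tens_linearl T)
    (fun k h k' h' => etrans (tens_inner T h k h' k') (mulrC _ _))
    (swap_dense T).

(** For fixed [k], the [h] with [T h k] in [S] form the preimage of [S] under a bounded operator, a
    closed subspace of [H] containing [E]. *)
Lemma basis_slices_total H K L (T : hilbert_tensor H K L) (E : set H) :
  total E -> total [set v | exists2 h, E h & exists k, v = T h k].
Proof.
move=> totE S clS ES; apply: (tens_total T) => // _ [h [k ->]].
have [closedS S0 SD] := clS.
pose Tk := slice (swap T) k.
apply: (totE [set h | S (T h k)]) => [|h' Eh' /=]; last first.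
  by apply: ES; exists h' => //; exists k.
split=> [||a u v Su Sv] /=.
- apply: (@closed_comp _ _ Tk S) => // h' _; by have [_] := bopP Tk; apply.
- by rewrite -[T 0 k]/(Tk 0) bop0.
- by rewrite tens_linearl; exact: SD.
Qed.

#[global] Arguments basis_slices_total {H K L} T {E}.

(** The operators involved are the mutually orthogonal projections |e_n><e_n| (x) 1, which vanish
    when [e n = 0]. *)
Lemma slice_Bessel H K L (T : hilbert_tensor H K L) e N v : orthobasis e ->
  \sum_(n < N) `|slice T (e n) (adj (slice T (e n)) v)| ^+ 2 <= `|v| ^+ 2.
Proof.
move=> [orth e01 _].
apply: (Bessel (Q := fun n => slice T (e n) ** adj (slice T (e n)))) => [m n mn|n].
  by rewrite /= tens_inner orth // mul0r.
rewrite -[inner _ v]/(inner (slice T (e n) (adj (slice T (e n)) v)) v) -adjE /=.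
have [->|en1] := e01 n.
  have -> : adj (slice T 0) v = 0.
    by apply: inner_inj => u; rewrite adjE slice0 bop0E linear0l linear0r.
  by rewrite linear0l -[T 0 0]/(slice T 0 0) bop0 normr0 expr0n.
by rewrite tens_norm exprMn -!inner_norm en1 mul1r.
Qed.

(** The partial sums [sum_(n < N) b (e n) ** adj (slice T (e n))] over an
    orthonormal basis [e] of [H] are uniformly bounded by Bessel's inequality. *)
Lemma tensor_lift H K L X (T : hilbert_tensor H K L) (b : H -> bop K X) (C : R[i]) :
  separable H -> 0 < C ->
  (forall a h h', b (a *: h + h') = a *: b h + b h') ->
  (forall h k, `|b h k| <= C * (`|h| * `|k|)) ->
  (forall h h' k k', inner h h' = 0 -> inner (b h k) (b h' k') = 0) ->
  exists Z : bop L X, forall h, Z ** slice T h = b h.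
Proof.
move=> /orthobasis_exists[e eO] C0 lb bC b_orth.
have [orth e01 tote] := eO.
pose l n := slice T (e n).
pose S N := \sum_(n < N) b (e n) ** adj (l n).
have b0 : b 0 = 0 by have := lb (-1) 0 0; rewrite scaler0 addr0 scaleN1r addNr.
have SC N v : `|S N v| <= C * `|v|.
  rewrite -(ler_pXn2r (n := 2)) ?nnegrE ?mulr_ge0 ?(ltW C0) //.
  rewrite /S bop_sumE (norm_sum_orthogonal
    (f := fun n => (b (e n) ** adj (l n)) v)); last first.
    by move=> m n mn /=; rewrite b_orth ?orth.
  rewrite exprMn; apply: (@le_trans _ _ (C ^+ 2 *
      \sum_(n < N) `|slice T (e n) (adj (slice T (e n)) v)| ^+ 2)); last first.
    by rewrite ler_pM2l ?exprn_gt0 //; exact: slice_Bessel.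
  rewrite mulr_sumr; apply: ler_sum => n _ /=.
  rewrite -exprMn ler_pXn2r ?nnegrE ?mulr_ge0 ?(ltW C0) //.
  by rewrite tens_norm bC.
have Se m k N : (m < N)%N -> S N (T (e m) k) = b (e m) k.
  move=> mN; rewrite /S bop_sumE (bigD1 (Ordinal mN)) //= big1 => [|n nm].
    rewrite addr0 adj_slice; have [->|->] := e01 m; last by rewrite scale1r.
    by rewrite b0.
  by rewrite adj_slice orth ?scale0r ?bop0 // eq_sym.
have Scvg m k : S N (T (e m) k) @[N --> \oo] --> b (e m) k.
  apply: cvg_near_cst; exists m.+1 => // N /= mN.
  by rewrite Se.
have [|Z ZP] := strong_limit C0 (basis_slices_total T tote) SC.
  by move=> _ [_ [m _ <-] [k ->]]; apply/cvg_ex; exists (b (e m) k); exact: Scvg.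
exists Z => h; apply: bopE => k /=.
(* For fixed [k] both sides are bounded operators in [h], so agreement on the basis suffices. *)
have [|h'|y yP] := @bop_exists _ H X (fun h => b h k) (C * `|k|).
- by move=> a h1 h2; rewrite lb.
- by rewrite -mulrA [`|k| * _]mulrC.
rewrite -yP -[Z _]/((Z ** slice (swap T) k) h); congr (bop_fun _ h).
apply: (total_eq tote) => _ [m _ <-]; rewrite yP /=.
exact: cvg_unique_norm (ZP _) (Scvg m k).
Qed.

End Tensor.

(** * Weak* convergence *)

Section DominatedSeries.
Context {R : realType}.

Lemma complex_cauchy_cvg (f : nat -> R[i]^o) :
  (forall eps : R[i], 0 < eps -> exists N, forall m n, (N <= m)%N -> (N <= n)%N ->
     `|f m - f n| < eps) -> cvgn f.
Proof.
move=> fc.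
have real_part (p : R[i] -> R) : (forall z w, p z - p w = p (z - w)) ->
    (forall z, (`|p z|)%:C <= `|z|) -> cvgn (fun n => p (f n)).
  move=> pB p_le; apply: cauchy_cvg; apply/cauchy_ballP => eps eps0.
  have [|N hN] := fc eps%:C; first by rewrite ltcR.
  near_simpl; near=> m n; rewrite -ball_normE /= pB -ltcR.
  apply: le_lt_trans (p_le _) _; apply: hN.
    by near: m; exists N.
  by near: n; exists N.
have absRe (z : R[i]) : (`|complex.Re z|)%:C <= `|z|.
  exact: normc_ge_Re.
have absIm (z : R[i]) : (`|complex.Im z|)%:C <= `|z|.
  by rewrite normc_def lecR -sqrtr_sqr ler_wsqrtr // lerDr sqr_ge0.
have cR := real_part _ (fun z w => esym (raddfB _ _ _)) absRe.
have cI := real_part _ (fun z w => esym (raddfB _ _ _)) absIm.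
apply/cvg_ex.
exists (Complex (limn (fun n => complex.Re (f n))) (limn (fun n => complex.Im (f n)))).
apply/cvgrPdist_lt => eps eps0.
have er : eps = (complex.Re eps)%:C.
  by case: eps eps0 => a b /=; rewrite ltcE /= => /andP[/eqP-> _].
have re0 : 0 < complex.Re eps / 2 by rewrite divr_gt0 // -ltcR -er.
near=> n; set z := _ - f n.
have z_le : `|z| <= (`|complex.Re z| + `|complex.Im z|)%:C.
  rewrite normc_def lecR -[leRHS]ger0_norm ?addr_ge0 // -sqrtr_sqr ler_wsqrtr //.
  by rewrite sqrrD !real_normK ?num_real // lerD2r lerDl mulrn_wge0 // mulr_ge0.
apply: le_lt_trans z_le _; rewrite er ltcR [ltRHS]splitr; apply: ltrD.
  rewrite /z raddfB /=; near: n; move/cvgrPdist_lt: cR; exact.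
rewrite /z raddfB /=; near: n; move/cvgrPdist_lt: cI; exact.
Unshelve. all: by end_near. Qed.

Lemma dominated_sum (c m : nat -> R[i]^o) p q : (forall j, `|c j| <= m j) ->
  (p <= q)%N -> `|series c q - series c p| <= `|series m q - series m p|.
Proof.
move=> cm pq; rewrite !sub_series_geq // [leRHS]ger0_norm; last first.
  by apply: sumr_ge0 => j _; apply: le_trans (cm j).
by apply: le_trans (ler_norm_sum _ _ _) _; apply: ler_sum => j _.
Qed.

Lemma dominated_cvg (c m : nat -> R[i]^o) : (forall j, `|c j| <= m j) ->
  cvgn (series m) -> cvgn (series c).
Proof.
move=> cm /cvgrPdist_lt m_cvg; apply: complex_cauchy_cvg => eps eps0.
have [N _ hN] := m_cvg _ (divr_gt0 eps0 (ltr0n _ 2)).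
have Nle p q : (N <= p <= q)%N -> `|series c q - series c p| < eps.
  move=> /andP[Np pq]; apply: le_lt_trans (dominated_sum cm pq) _.
  have -> : series m q - series m p =
    (limn (series m) - series m p) - (limn (series m) - series m q) by ring.
  apply: le_lt_trans (ler_normB _ _) _.
  have -> : eps = eps / 2 + eps / 2 by field.
  by rewrite ltrD //; apply: hN => //=; apply: leq_trans pq.
exists N => p q Np Nq; have [pq|/ltnW qp] := leqP p q.
  by rewrite distrC Nle // Np.
by rewrite Nle // Nq.
Qed.

(** The cut-off [N] comes from the series of [m] alone, which makes it uniform in [c]. *)
Lemma dominated_tail (m : nat -> R[i]^o) (eps : R[i]) :
  cvgn (series m) -> 0 < eps -> exists N, forall c : nat -> R[i]^o,
    (forall j, `|c j| <= m j) -> `|limn (series c) - series c N| < eps.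
Proof.
move=> m_cvg eps0; have e3 : 0 < eps / 3 by rewrite divr_gt0.
have /cvgrPdist_lt/(_ _ e3)[N _ hN] := m_cvg.
exists N => c cm.
have /cvgrPdist_lt/(_ _ e3)[M _ hM] := dominated_cvg cm m_cvg.
pose p := maxn N M; have Np : (N <= p)%N by rewrite leq_maxl.
have -> : limn (series c) - series c N =
  (limn (series c) - series c p) + (series c p - series c N) by ring.
have -> : eps = eps / 3 + (eps / 3 + eps / 3) by field.
apply: le_lt_trans (ler_normD _ _) _; apply: ltrD.
  by apply: hM => /=; rewrite leq_maxr.
apply: le_lt_trans (dominated_sum cm Np) _.
have -> : series m p - series m N =
  (limn (series m) - series m N) - (limn (series m) - series m p) by ring.
by apply: le_lt_trans (ler_normB _ _) _; rewrite ltrD //; apply: hN => /=.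
Qed.

Lemma cvg_series_term (c : nat -> nat -> R[i]^o) (d : nat -> R[i]^o) J :
  (forall j, c n j @[n --> \oo] --> d j) ->
  series (c n) J @[n --> \oo] --> series d J.
Proof.
move=> cd; elim: J => [|J IHJ].
  have e : (fun n => series (c n) 0%N) = cst 0.
    by apply/funext => n; rewrite /series /= big_geq.
  rewrite e (_ : series d 0%N = 0); first exact: cvg_cst.
  by rewrite /series /= big_geq.
have e : (fun n => series (c n) J.+1) = (fun n => series (c n) J + c n J).
  by apply/funext => n; rewrite seriesSr.
by rewrite e seriesSr; apply: cvgD; [exact: IHJ | exact: cd].
Qed.

(** Dominated convergence: beyond a common index [J] all tails are small, and the first [J] terms
    converge one by one. *)
Lemma dominated_series_cvg (c : nat -> nat -> R[i]^o) (d m : nat -> R[i]^o) :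
  (forall n j, `|c n j| <= m j) -> (forall j, `|d j| <= m j) ->
  cvgn (series m) -> (forall j, c n j @[n --> \oo] --> d j) ->
  limn (series (c n)) @[n --> \oo] --> limn (series d).
Proof.
move=> cm dm m_cvg cd; apply/cvgrPdist_lt => eps eps0.
have e3 : 0 < eps / 3 by rewrite divr_gt0.
have [J hJ] := dominated_tail m_cvg e3.
have SJ : series (c n) J @[n --> \oo] --> series d J.
  exact: cvg_series_term.
near=> n.
have -> : limn (series d) - limn (series (c n)) =
    (limn (series d) - series d J) + (series d J - series (c n) J)
    - (limn (series (c n)) - series (c n) J) by ring.
have -> : eps = eps / 3 + eps / 3 + eps / 3 by field.
apply: le_lt_trans (ler_normB _ _) _; apply: ltrD; last exact: hJ.
apply: le_lt_trans (ler_normD _ _) _; apply: ltrD; first exact: hJ.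
by near: n; move/cvgrPdist_lt: SJ; apply.
Unshelve. all: by end_near. Qed.

End DominatedSeries.

Section WeakStar.
Context {R : realType}.
Implicit Types H K X : hilbertType R.

Lemma cvg_initial (S : choiceType) (T : topologicalType) (f : S -> T) I
    (F : set_system I) {FF : Filter F} (g : I -> S) (s : S) :
  (g i : initial_topology f) @[i --> F] --> (s : initial_topology f) <->
  f (g i) @[i --> F] --> f s.
Proof.
split=> [gs|fgs].
  exact: (cvg_comp _ _ gs (@initial_continuous _ _ f s)).
move=> A; rewrite nbhsE => -[_ [[B oB <-] Bs] BA].
have /fgs FB : nbhs (f s) B by apply: open_nbhs_nbhs.
have {}FB : F [set i | B (f (g i))] by exact: FB.
exact: (@filterS _ F FF _ _ (fun i Bi => BA (g i) Bi) FB).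
Qed.

(** Two layers are unfolded: [weakstar] is initial for a map into a pointwise topology, itself a
    supremum of initial topologies of evaluations. *)
Lemma weakstar_cvgP H I (F : set_system I) {FF : Filter F} (T : I -> bop H H)
    (x : bop H H) :
  (T i : weakstar H) @[i --> F] --> (x : weakstar H) <->
  forall ab, weakstar_functional ab (T i) @[i --> F] --> weakstar_functional ab x.
Proof.
have FT := @fmap_filter _ _ (fun i ab => weakstar_functional ab (T i)) _ FF.
split=> [/cvg_initial/(cvg_sup _ _ FT) Tx ab|Tx].
  exact: (proj1 (@cvg_initial _ _ (fun f => f ab) _ _ FF
    (fun i ab => weakstar_functional ab (T i))
    (fun ab => weakstar_functional ab x)) (Tx ab)).
apply/(@cvg_initial _ _ _ _ _ FF).
apply/(cvg_sup _ _ FT) => ab.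
apply: (proj2 (@cvg_initial _ _ (fun f => f ab) _ _ FF
  (fun i ab => weakstar_functional ab (T i)) (fun ab => weakstar_functional ab x))).
exact: Tx.
Qed.

(** The hypothesis asks for a pre-adjoint of [phi]: every functional of the predual pulls back to
    one. *)
Lemma normalP H K (phi : bop H H -> bop K K) :
  (forall ab, exists cd, forall x,
     weakstar_functional ab (phi x) = weakstar_functional cd x) -> normal phi.
Proof.
move=> hphi x.
have id_cvg : (z : weakstar H) @[z --> (x : weakstar H)] --> (x : weakstar H).
  exact: cvg_id.
apply/(@weakstar_cvgP K (bop H H) (nbhs (x : weakstar H)) _ phi (phi x)) => ab.
have [cd abcd] := hphi ab; rewrite abcd (_ : (fun _ => _) = weakstar_functional cd).
  by move/(@weakstar_cvgP H (bop H H) (nbhs (x : weakstar H)) _ id x): id_cvg; exact.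
exact/funext.
Qed.

Lemma normal_comp H K X (phi : bop K K -> bop X X) (psi : bop H H -> bop K K) :
  normal phi -> normal psi -> normal (phi \o psi).
Proof.
move=> cphi cpsi x.
exact: (@continuous_comp (weakstar H) (weakstar K) (weakstar X) psi phi x
  (cpsi x) (cphi (psi x))).
Qed.

(** The pre-adjoint applies the isometry [adj c] termwise, which preserves square-summability. *)
Lemma normal_conj H K (c : bop H K) : c ** adj c = bid K ->
  normal (fun z => c ** z ** adj c).
Proof.
move=> cc; have c_norm v : `|adj c v| = `|v| by apply: isometry_norm; rewrite adjK.
have sq (a : nat -> K) : square_summable a -> square_summable (adj c \o a).
  rewrite /square_summable (_ : (fun n => _) = fun n => `|a n| ^+ 2) //.
  by apply/funext => n /=; rewrite c_norm.
apply: normalP => -[[a sa] [b sb]].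
exists (exist _ _ (sq a sa), exist _ _ (sq b sb)) => x.
rewrite /weakstar_functional /=; congr (limn (series _)); apply/funext => n.
by rewrite adjE.
Qed.

(** For contractions the terms of a weak* functional are dominated by [|a j| ^+ 2 + |b j| ^+ 2],
    whatever [n], so dominated convergence applies. *)
Lemma strong_weakstar_cvg H (T : nat -> bop H H) (x : bop H H) :
  (forall n v, `|T n v| <= `|v|) -> (forall v, `|x v| <= `|v|) ->
  (forall v, T n v @[n --> \oo] --> x v) ->
  (T n : weakstar H) @[n --> \oo] --> (x : weakstar H).
Proof.
move=> T1 x1 Tx; apply/weakstar_cvgP => -[[a sa] [b sb]].
have bound (y : bop H H) j : (forall v, `|y v| <= `|v|) ->
    `|inner (y (a j)) (b j)| <= `|a j| ^+ 2 + `|b j| ^+ 2.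
  move=> y1; apply: le_trans (inner_CauchySchwarz _ _) _.
  apply: (@le_trans _ _ (`|a j| * `|b j|)); first by rewrite ler_wpM2r.
  have [ab|/ltW ba] := real_leP (normr_real (a j)) (normr_real (b j)).
    by rewrite (le_trans (ler_wpM2r _ ab)) // -expr2 lerDr exprn_ge0.
  by rewrite (le_trans (ler_wpM2l _ ba)) // -expr2 lerDl exprn_ge0.
apply: (@dominated_series_cvg R _ _ (fun j => `|a j| ^+ 2 + `|b j| ^+ 2)) => /=.
- by move=> n j; apply: bound.
- by move=> j; apply: bound.
- exact: is_cvg_seriesD sa sb.
- by move=> j; apply: cvg_innerl.
Qed.

Lemma single_series (u : nat -> R[i]^o) : (forall n, u n.+1 = 0) ->
  series u n @[n --> \oo] --> u 0%N.
Proof.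
move=> u0; apply: cvg_near_cst; exists 1%N => // n /= n1; rewrite /series /=.
rewrite big_ltn // big_nat big1 ?addr0 // => -[|j] //= /andP[]//.
Qed.

(** The sequences (v, 0, 0, ...) exhibit the functionals [x |-> inner (x u) v] as weak*
    functionals. *)
Lemma single_square_summable H (v : H) :
  square_summable (fun n => if n is 0%N then v else 0).
Proof.
by apply/cvg_ex; exists (`|v| ^+ 2); apply: single_series => n; rewrite normr0 expr0n.
Qed.

#[global] Arguments single_square_summable {H} v.

Lemma weakstar_inner_cvg H I (F : set_system I) {FF : Filter F} (T : I -> bop H H)
    (x : bop H H) u v : (T i : weakstar H) @[i --> F] --> (x : weakstar H) ->
  (inner (T i u) v : R[i]^o) @[i --> F] --> (inner (x u) v : R[i]^o).
Proof.
move/weakstar_cvgP/(_ (exist _ _ (single_square_summable u),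
  exist _ _ (single_square_summable v))).
have fE y : weakstar_functional (exist _ _ (single_square_summable u),
  exist _ _ (single_square_summable v)) y = inner (y u) v.
  apply: cvg_lim; first exact: norm_hausdorff.
  apply: single_series => n /=; by rewrite linear0r.
by rewrite fE (_ : (fun i => _) = (fun i => inner (T i u) v)) //; apply/funext => i.
Qed.

End WeakStar.

(** * Amplifications *)

Section TensorOperators.
Context {R : realType}.
Implicit Types H K L X : hilbertType R.

Lemma bcompDr H K X (x : bop K X) a (y z : bop H K) :
  x ** (a *: y + z) = a *: (x ** y) + x ** z.
Proof. by apply: bopE => v; rewrite -[LHS]/(x (a *: y v + z v)) bopD bopZ. Qed.

Lemma bcompZr H K X (x : bop K X) a (y : bop H K) : x ** (a *: y) = a *: (x ** y).
Proof. by apply: bopE => v; rewrite -[LHS]/(x (a *: y v)) bopZ. Qed.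

Lemma bcompDl H K X (x y : bop K X) a (z : bop H K) :
  (a *: x + y) ** z = a *: (x ** z) + y ** z.
Proof. exact: bopE. Qed.

Lemma bcompZl H K X (x : bop K X) a (z : bop H K) : (a *: x) ** z = a *: (x ** z).
Proof. exact: bopE. Qed.

Lemma adj_slice_slice H K L (T : hilbert_tensor H K L) h h' :
  adj (slice T h) ** slice T h' = inner h' h *: bid K.
Proof. by apply: bopE => k; rewrite /= adj_slice. Qed.

Lemma slice_ext2 H K L (T : hilbert_tensor H K L) (x y : bop L L) :
  (forall h h', adj (slice T h') ** x ** slice T h =
                adj (slice T h') ** y ** slice T h) ->
  x = y.
Proof.
move=> xy; apply: (slice_ext (T := T)) => h.
rewrite -[LHS]adjK -[RHS]adjK; congr adj.
apply: (slice_ext (T := T)) => h'.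
rewrite -[LHS]adjK -[RHS]adjK; congr adj.
by rewrite !adjM !adjK !bcompA.
Qed.

(** x (x) y is the product of 1 (x) y and x (x) 1, the latter obtained from the swapped tensor
    product. *)
Lemma tensop_exists H K L (T : hilbert_tensor H K L) (x : bop H H) (y : bop K K) :
  separable H -> separable K ->
  exists z : bop L L, forall h k, z (T h k) = T (x h) (y k).
Proof.
move=> sepH sepK.
have ampr H' K' (T' : hilbert_tensor H' K' L) (y' : bop K' K') : separable H' ->
    exists z : bop L L, forall h k, z (T' h k) = T' h (y' k).
  move=> sepH'; have [C C0 yC] := bop_bounded y'.
  have [|h k|h h' k k' hh'|Z ZP] :=
    @tensor_lift R H' K' L L T' (fun h => slice T' h ** y') C sepH' C0.
  - by move=> a h h'; rewrite slice_linear bcompDl.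
  - by rewrite /= tens_norm mulrCA ler_wpM2l.
  - by rewrite /= tens_inner hh' mul0r.
  by exists Z => h k; rewrite -[LHS]/((Z ** slice T' h) k) ZP.
have [z zP] := ampr _ _ T y sepH; have [w wP] := ampr _ _ (swap T) x sepK.
by exists (w ** z) => h k /=; rewrite zP; exact: wP.
Qed.

Lemma tensopE H K L (T : hilbert_tensor H K L) (x : bop H H) (y : bop K K) h k :
  separable H -> separable K -> tensop T x y (T h k) = T (x h) (y k).
Proof.
move=> sepH sepK; exact: (xgetPex 0 (tensop_exists T x y sepH sepK)).
Qed.

Lemma tensop_slice H K L (T : hilbert_tensor H K L) (x : bop H H) (y : bop K K) h :
  separable H -> separable K ->
  tensop T x y ** slice T h = slice T (x h) ** y.
Proof. by move=> sepH sepK; apply: bopE => k /=; rewrite tensopE. Qed.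

Lemma tensop_ketbra H K L (T : hilbert_tensor H K L) (h h' : H) (y : bop K K) :
  separable H -> separable K ->
  tensop T (ketbra h h') y = slice T h ** y ** adj (slice T h').
Proof.
move=> sepH sepK; apply: (slice_ext (T := T)) => g.
rewrite tensop_slice // -!bcompA adj_slice_slice /= !bcompZr bcomp1.
by have := slice_linear T (inner g h') h 0; rewrite slice0 !addr0 => ->; rewrite bcompZl.
Qed.

(** [Q N] is P_N (x) 1, with P_N the projection onto the span of the first [N] basis vectors; on
    each [T (e m) k] it is eventually the identity. *)
Lemma slice_projections_cvg H K L (T : hilbert_tensor H K L) : separable H ->
  exists Q : nat -> bop L L, [/\ forall N v, `|Q N v| <= `|v|,
    forall v, Q N v @[N --> \oo] --> v &
    exists e : nat -> H, forall N,
      Q N = \sum_(n < N) slice T (e n) ** adj (slice T (e n))].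
Proof.
move=> /orthobasis_exists[e eO]; have [orth e01 tote] := eO.
pose Q N := \sum_(n < N) slice T (e n) ** adj (slice T (e n)).
have Q1 N v : `|Q N v| <= `|v|.
  rewrite -(ler_pXn2r (n := 2)) ?nnegrE //.
  rewrite /Q bop_sumE (norm_sum_orthogonal
    (f := fun n => (slice T (e n) ** adj (slice T (e n))) v)); last first.
    by move=> m n mn /=; rewrite tens_inner orth // mul0r.
  exact: slice_Bessel.
exists Q; split=> //; last by exists e.
have Qsub : closed_subspace [set v | Q N v @[N --> \oo] --> bid L v].
  by apply: (@cvg_closed_subspace _ _ _ _ _ _ _ _ 1) => //; apply: nearW => N v;
    rewrite mul1r.
move=> v; apply: (basis_slices_total T tote _ Qsub) v => _ [_ [m _ <-] [k ->]] /=.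
apply: cvg_near_cst; exists m.+1 => // N /= mN.
rewrite /Q bop_sumE (bigD1 (Ordinal mN)) //= big1 => [|n nm].
  rewrite addr0 adj_slice; have [->|->] := e01 m; last by rewrite scale1r.
  by rewrite -![T 0 _]/(slice T 0 _) slice0.
by rewrite adj_slice orth ?scale0r -?[T _ 0]/(slice T _ 0) ?bop0 // eq_sym.
Qed.

End TensorOperators.

(** * Existence of the amplification *)

Section Amplification.
Context {R : realType} {H K L : hilbertType R} (T : hilbert_tensor H K L).
Hypotheses (sepH : separable H) (sepK : separable K).
Local Notation l := (slice T).

Lemma slice_isometry h : inner h h = 1 -> adj (l h) ** l h = bid K.
Proof. by move=> h1; rewrite adj_slice_slice h1 scale1r. Qed.

Lemma star_endo_adj (phi : bop K K -> bop K K) x y u v : star_endo phi ->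
  inner (phi x u) (phi y v) = inner (phi (adj y ** x) u) v.
Proof. by move=> [_ pM pS]; rewrite pM pS /= adjP. Qed.

(** [U (h (x) k) = phi (s ** l_h) k] defines a unitary [U : L -> K], and
    [Phi z = adj U ** phi (s ** z ** adj s) ** U]. Surjectivity of [U]
    comes from the normality of [phi]. *)
Lemma amplification_exists (s : bop L K) (phi : bop K K -> bop K K) :
  unitary s -> star_endo phi -> normal phi -> phi (bid K) = bid K ->
  exists Phi : bop L L -> bop L L, [/\ star_endo Phi, normal Phi &
    forall x y, Phi (tensop T x y) = tensop T x (phi y)].
Proof.
move=> [s1 s2] phiE phiN phi1; have [phiL phiM phiS] := phiE.
have phiZ a x : phi (a *: x) = a *: phi x.
  have phi0 : phi 0 = 0.
    by have := phiL (-1) 0 0; rewrite scaler0 addr0 scaleN1r addNr.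
  by have := phiL a x 0; rewrite phi0 !addr0.
pose b h := phi (s ** l h).
have b_inner h h' k k' : inner (b h k) (b h' k') = inner h h' * inner k k'.
  rewrite /b star_endo_adj // adjM bcompA -[_ ** adj s ** s]bcompA s1 bcomp1.
  by rewrite adj_slice_slice phiZ phi1 bopZE innerZl.
have [||h k|h h' k k' hh'|U UP] := @tensor_lift R H K L K T b 1 sepH.
- exact: ltr01.
- by move=> a h h'; rewrite /b slice_linear bcompDr phiL.
- rewrite mul1r -(ler_pXn2r (n := 2)) ?nnegrE ?mulr_ge0 //.
  by rewrite exprMn -!inner_norm b_inner.
- by rewrite b_inner hh' mul0r.
have U1 : adj U ** U = bid L.
  apply: (slice_ext2 (T := T)) => h h'; apply: bopE => k; apply: inner_inj => k'.
  rewrite bcomp1 -!bcompA UP /= !adjE -[U _]/((U ** l h') k') UP b_inner.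
  by rewrite tens_inner.
have U2 : U ** adj U = bid K.
  apply: bopE => v /=; apply/eqP; rewrite eq_sym -subr_eq0; apply/eqP.
  (* [w] is the component of [v] orthogonal to the range of [U]; the aim is [w = 0]. *)
  set w := v - _.
  have Uw : adj U w = 0.
    rewrite /w bopB -[adj U (U _)]/((adj U ** U) (adj U v)) U1.
    by rewrite -[bid L _]/(adj U v) subrr.
  have [Q [Q1 Qv [e QE]]] := slice_projections_cvg T sepH.
  pose Q' N := s ** Q N ** adj s.
  (* [phi (Q' N)] is a sum of terms [U ** l (e n) ** adj (U ** l (e n))], each killing [w] since
     [adj U w = 0]. *)
  have Q'w N : phi (Q' N) w = 0.
    have -> : Q' N = \sum_(n < N) (s ** l (e n)) ** adj (s ** l (e n)).
      apply: bopE => u; rewrite /Q' QE bop_sumE /= bop_sumE bop_sum.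
      by apply: eq_bigr => n _; rewrite adjM.
    rewrite (big_morph phi (id1 := 0) (op1 := +%R)); last 2 first.
    - by move=> x y; rewrite -[x]scale1r phiL !scale1r.
    - by rewrite -(scale0r (0 : bop K K)) phiZ !scale0r.
    rewrite bop_sumE big1 // => n _; rewrite phiM phiS /= -[phi _]UP adjM /=.
    by rewrite Uw bop0 -[T _ 0]/(l (e n) 0) !bop0.
  have Q'1 : (Q' N : weakstar K) @[N --> \oo] --> (bid K : weakstar K).
    apply: strong_weakstar_cvg => //.
    - move=> N u /=; rewrite (isometry_norm s1); apply: le_trans (Q1 _ _) _.
      by rewrite (isometry_norm (x := adj s)) ?adjK.
    - move=> u; have -> : bid K u = s (adj s u) by rewrite -s2.
      exact: bop_cvg.
  (* By normality [phi (Q' N)] tends to the identity, so [inner w w] is the limit of a null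
     sequence. *)
  have := @weakstar_inner_cvg R K nat _ _ (fun N => phi (Q' N)) _ w w
    (cvg_comp _ _ Q'1 (phiN (bid K))).
  rewrite phi1 (_ : (fun i => _) = cst 0); last first.
    by apply/funext => N; rewrite Q'w linear0l.
  move=> w0; apply: inner_eq0.
  have c0 : @cst nat R[i]^o 0 @ \oo --> (0 : R[i]^o) by exact: cvg_cst.
  exact: (@cvg_unique_norm R R[i]^o nat \oo _ _ _ _ (w0 _) c0).
exists (fun z => adj U ** phi (s ** z ** adj s) ** U); split.
- split.
  + by move=> a x y; rewrite bcompDr bcompDl phiL bcompDr bcompDl.
  + move=> x y.
    have -> : s ** (x ** y) ** adj s = (s ** x ** adj s) ** (s ** y ** adj s).
      rewrite !bcompA -[_ ** adj s ** s]bcompA s1 bcomp1; congr (_ ** _).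
    rewrite phiM !bcompA; congr (_ ** _).
    by rewrite -[_ ** U ** adj U]bcompA U2 bcomp1.
  + by move=> x; rewrite !adjM adjK -phiS !adjM adjK !bcompA.
- have -> : (fun z => adj U ** phi (s ** z ** adj s) ** U) =
      (fun z => adj U ** z ** adj (adj U)) \o phi \o (fun z => s ** z ** adj s).
    by apply/funext => z /=; rewrite adjK.
  apply: normal_comp; last exact: normal_conj.
  apply: normal_comp => //; apply: normal_conj; by rewrite adjK.
(* Both sides compress to [inner (x h) h' *: phi y]. *)
- move=> x y; apply: (slice_ext2 (T := T)) => h h'.
  have -> : adj (l h') ** (adj U ** phi (s ** tensop T x y ** adj s) ** U) ** l h =
      adj (U ** l h') ** phi (s ** tensop T x y ** adj s) ** (U ** l h).
    by rewrite adjM !bcompA.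
  rewrite !UP -phiS -!phiM adjM.
  have -> : adj (l h') ** adj s ** (s ** tensop T x y ** adj s) ** (s ** l h) =
      adj (l h') ** (adj s ** s) ** tensop T x y ** (adj s ** s) ** l h.
    by rewrite !bcompA.
  rewrite s1 !bcomp1 -!bcompA !tensop_slice // !bcompA !adj_slice_slice.
  by rewrite !bcompZl !bcomp1l phiZ.
Qed.

End Amplification.

(** * Cocycles of an amplification *)

Section SemigroupContinuity.
Context {R : realType}.
Implicit Types H K L : hilbertType R.

Lemma sqr_normB_le H (a b : H) :
  `|a - b| ^+ 2 <= `|inner a a - inner b b| + 2 * `|inner a b - inner b b|.
Proof.
set p := inner a a - inner b b; set q := inner a b - inner b b.
have -> : `|a - b| ^+ 2 = p - (q + q^*%R).
  rewrite -inner_norm linearBl !linearBr /= /p /q rmorphB /= -!innerC; ring.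
have h : `|p - (q + q^*%R)| <= `|p| + 2 * `|q|.
  apply: le_trans (ler_normB _ _) _; rewrite lerD2l.
  by apply: le_trans (ler_normD _ _) _; rewrite norm_conjC mulr_natl mulr2n.
apply: le_trans h; apply: real_ler_norm.
suff -> : p - (q + q^*%R) = `|a - b| ^+ 2 by rewrite realX ?normr_real.
by rewrite -inner_norm linearBl !linearBr /= /p /q rmorphB /= -!innerC; ring.
Qed.

(** Since [|beta t x v| ^+ 2 = inner (beta t (adj x ** x) v) v], weak* continuity at [adj x ** x]
    controls the norms, and [sqr_normB_le] upgrades weak to strong convergence. *)
Lemma E0_strong_cvg H (beta : R -> bop H H -> bop H H) x v (t0 : R) :
  E0_semigroup beta -> 0 <= t0 ->
  beta t x v @[t --> within [set t : R | 0 <= t] (nbhs t0)] --> beta t0 x v.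
Proof.
move=> [bE _ _ bC] t0_ge0; set F := within _ _.
have weak y u w : (inner (beta t y u) w : R[i]^o) @[t --> F] -->
    (inner (beta t0 y u) w : R[i]^o).
  apply: weakstar_inner_cvg.
  by have /subspace_continuousP := bC y; apply.
apply/cvgrPdist_lt => eps eps0.
have e3 : 0 < eps ^+ 2 / 3 by rewrite divr_gt0 ?exprn_gt0.
have near_ge0 : \forall t \near F, 0 <= t.
  by rewrite /F; apply: withinT; exact: nbhs_filter.
have inner_beta t : 0 <= t -> inner (beta t x v) (beta t x v) =
    inner (beta t (adj x ** x) v) v.
  by move=> /bE[bt _ _]; exact: star_endo_adj.
near=> t.
have tge0 : 0 <= t by near: t.
rewrite distrC -(ltr_pXn2r (n := 2)) ?nnegrE ?normr_ge0 ?(ltW eps0) //.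
apply: le_lt_trans (sqr_normB_le _ _) _.
rewrite !inner_beta //.
have -> : eps ^+ 2 = eps ^+ 2 / 3 + 2 * (eps ^+ 2 / 3) by field.
apply: ltrD; first by near: t; move/cvgrPdistC_lt: (weak (adj x ** x) v v); apply.
rewrite ltr_pM2l // -inner_beta //.
by near: t; move/cvgrPdistC_lt: (weak x v (beta t0 x v)); apply.
Unshelve. all: by end_near. Qed.

End SemigroupContinuity.

(** * The cocycle attached to a unitary from [L] onto [K] *)

Section AdaptedCocycle.
Context {R : realType} {H K L : hilbertType R} (T : hilbert_tensor H K L).
Hypotheses (sepH : separable H) (sepK : separable K).
Variables (delta : H) (delta_unit : `|delta| = 1).
Variables (gamma : R -> bop K K -> bop K K) (gammaE0 : E0_semigroup gamma).
Variables (s : bop L K) (s_unitary : unitary s).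
Local Notation l := (slice T).
Local Notation Phi t := (amplification T (gamma t)).
Let hatw := l delta ** s.
Let u t := adj hatw ** Phi t hatw.

Lemma slice_delta : adj (l delta) ** l delta = bid K.
Proof.
by rewrite (@slice_isometry _ _ _ _ T) // inner_norm delta_unit expr1n.
Qed.

(** The unitary [s] provides existence, so [xget] returns a genuine amplification. *)
Lemma ampP t : 0 <= t -> [/\ star_endo (Phi t), normal (Phi t) &
    forall x y, Phi t (tensop T x y) = tensop T x (gamma t y)].
Proof.
move=> t0; have [gE _ _ _] := gammaE0; have [g1 g2 g3] := gE t t0.
exact: (@xgetPex (bop L L -> bop L L)%type idfun _
  (amplification_exists T sepH sepK s_unitary g1 g2 g3)).
Qed.

Lemma ampM t x y : 0 <= t -> Phi t (x ** y) = Phi t x ** Phi t y.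
Proof. by move=> /ampP[[]]. Qed.

Lemma amp_adj t x : 0 <= t -> Phi t (adj x) = adj (Phi t x).
Proof. by move=> /ampP[[]]. Qed.

Lemma gamma1 t : 0 <= t -> gamma t (bid K) = bid K.
Proof. by move=> t0; have [/(_ t t0)[]] := gammaE0. Qed.

Lemma gammaM t x y : 0 <= t -> gamma t (x ** y) = gamma t x ** gamma t y.
Proof. by move=> t0; have [/(_ t t0)[[]]] := gammaE0. Qed.

Lemma amp_tensop t h h' y : 0 <= t ->
  Phi t (l h ** y ** adj (l h')) = l h ** gamma t y ** adj (l h').
Proof. by move=> /ampP[_ _ PT]; rewrite -!tensop_ketbra. Qed.

(** These compressions determine [Phi t]. *)
Lemma amp_slice t z h h' : 0 <= t ->
  adj (l h') ** Phi t z ** l h = gamma t (adj (l h') ** z ** l h).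
Proof.
(* [E g] is |g><delta| (x) 1: it is fixed by [Phi t] and moves [l delta] to [l g], so it can be
   taken inside [Phi t]. *)
move=> t0; pose E g := l g ** adj (l delta).
have PE g : Phi t (E g) = E g.
  by have := amp_tensop g delta (bid K) t0; rewrite gamma1 // bcomp1.
have lE g : l g = E g ** l delta by rewrite /E -bcompA slice_delta bcomp1.
rewrite [in LHS](lE h) [in LHS](lE h') adjM.
have -> : adj (l delta) ** adj (E h') ** Phi t z ** (E h ** l delta) =
    adj (l delta) ** (adj (E h') ** Phi t z ** E h) ** l delta.
  by rewrite !bcompA.
rewrite -{1}(PE h') -{1}(PE h) -amp_adj // -!ampM //.
(* This has the form |delta><delta| (x) y, on which [Phi t] acts as [gamma t] on [y]. *)
have -> : adj (E h') ** z ** E h =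
    l delta ** (adj (l h') ** z ** l h) ** adj (l delta).
  by rewrite /E adjM adjK !bcompA.
rewrite amp_tensop //.
set y := gamma t _.
have -> : adj (l delta) ** (l delta ** y ** adj (l delta)) ** l delta =
  (adj (l delta) ** l delta) ** y ** (adj (l delta) ** l delta) by rewrite !bcompA.
by rewrite slice_delta bcomp1 bcomp1l.
Qed.

Lemma amp1 t : 0 <= t -> Phi t (bid L) = bid L.
Proof.
move=> t0; have [_ _ PT] := ampP t0.
have <- : tensop T (bid H) (bid K) = bid L.
  by apply: (slice_ext (T := T)) => h; rewrite tensop_slice // bcomp1 bcomp1l.
by rewrite PT gamma1.
Qed.

Lemma hatw_isometry : adj hatw ** hatw = bid L.
Proof.
have [s1 _] := s_unitary.
by rewrite /hatw adjM bcompA -[_ ** l delta]bcompA slice_delta bcomp1.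
Qed.

Lemma hatw_range : hatw ** adj hatw = l delta ** bid K ** adj (l delta).
Proof.
have [_ s2] := s_unitary.
by rewrite /hatw adjM bcompA -[_ ** s ** _]bcompA s2.
Qed.

(** The range projection is |delta><delta| (x) 1. Its invariance underlies both the unitarity and
    the cocycle law of [u]. *)
Lemma amp_what_range t : 0 <= t -> Phi t (hatw ** adj hatw) = hatw ** adj hatw.
Proof. by move=> t0; rewrite hatw_range amp_tensop // gamma1. Qed.

(** [adj hatw] supplies the left factor [adj (l delta)] of a compression of [Phi t hatw], and
    [adj (l delta) ** hatw = s]; thus [delta] disappears. *)
Lemma cocycle_slice t h : 0 <= t -> u t ** l h = adj s ** gamma t (s ** l h).
Proof.
move=> t0; rewrite /u {1}/hatw adjM -!bcompA; congr (_ ** _).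
rewrite bcompA amp_slice //; congr (gamma t _).
by rewrite /hatw !bcompA slice_delta bcomp1l.
Qed.

Lemma cocycle_unitary t : 0 <= t -> unitary (u t).
Proof.
move=> t0; split; rewrite /u adjM adjK -amp_adj // bcompA.
  rewrite -[_ ** hatw ** adj hatw]bcompA -(amp_what_range t0) -!ampM //.
  by rewrite bcompA hatw_isometry bcomp1l hatw_isometry amp1.
rewrite -[_ ** Phi t hatw ** _]bcompA -ampM // amp_what_range //.
by rewrite bcompA hatw_isometry bcomp1l hatw_isometry.
Qed.

(** On the slice [l h] both sides equal [adj s ** gamma t (s ** x ** l h)]. *)
Lemma cocycle_amp t x : 0 <= t ->
  u t ** Phi t x = adj s ** gamma t (s ** x ** adj s) ** s ** u t.
Proof.
move=> t0; have [s1 s2] := s_unitary.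
apply: (slice_ext (T := T)) => h.
rewrite -[RHS]bcompA cocycle_slice // !bcompA -[_ ** s ** adj s]bcompA s2 bcomp1.
rewrite -[RHS]bcompA -gammaM //.
have -> : s ** x ** adj s ** (s ** l h) = s ** x ** (adj s ** s) ** l h.
  by rewrite !bcompA.
rewrite s1 bcomp1 {1}/u {1}/hatw adjM -!bcompA; congr (_ ** _).
rewrite [Phi t hatw ** _]bcompA -ampM // bcompA amp_slice //; congr (gamma t _).
by rewrite /hatw !bcompA slice_delta bcomp1l.
Qed.

Lemma cocycle_conj t x : 0 <= t ->
  adj s ** gamma t (s ** x ** adj s) ** s = u t ** Phi t x ** adj (u t).
Proof.
move=> t0; have [_ u2] := cocycle_unitary t0.
by rewrite cocycle_amp // -[RHS]bcompA u2 bcomp1.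
Qed.

Lemma amplification_cocycle : cocycle (fun t => Phi t) u.
Proof.
have [gE g0 gD _] := gammaE0; split.
- exact: cocycle_unitary.
- move=> v; apply/subspace_continuousP => t0 /= t0_ge0.
  set F := within _ _.
  have near_ge0 : \forall t \near F, 0 <= t.
    by rewrite /F; apply: withinT; exact: nbhs_filter.
  (* As the [u t] are isometries for [t >= 0], continuity need only be checked on elementary
     tensors, where it is the strong continuity of [gamma]. *)
  have clS : closed_subspace [set v | u t v @[t --> F] --> u t0 v].
    apply: (@cvg_closed_subspace _ _ _ _ _ _ _ _ 1) => //.
    near=> t => w; rewrite mul1r (isometry_norm (x := u t)) //.
    by have [] // := @cocycle_unitary t; near: t.
  apply: (tens_total T _ clS) => _ [h [k ->]].
  have uE t : 0 <= t -> u t (T h k) = adj s (gamma t (s ** l h) k).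
    by move=> tge0; rewrite -[LHS]/((u t ** l h) k) cocycle_slice.
  suff : u t (T h k) @[t --> F] --> u t0 (T h k) by [].
  rewrite uE //.
  apply: (@cvg_trans _ (adj s (gamma t (s ** l h) k) @[t --> F])).
    apply: near_eq_cvg; near=> t; rewrite uE //; by near: t.
  by apply: bop_cvg; exact: E0_strong_cvg.
- have P0 : Phi 0 hatw = hatw.
    by apply: (slice_ext2 (T := T)) => h h'; rewrite amp_slice // g0.
  by rewrite /u P0 hatw_isometry.
- move=> r t r0 t0.
  (* Compressions transfer the semigroup law from [gamma] to the amplification. *)
  have PD : Phi (t + r) hatw = Phi t (Phi r hatw).
    apply: (slice_ext2 (T := T)) => h h'; rewrite !amp_slice ?addr_ge0 //.
    exact: gD.
  (* The middle factor [Phi t (hatw ** adj hatw)] equals [hatw ** adj hatw] and is absorbed by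
     [adj hatw] on its left. *)
  rewrite /u PD [Phi t (adj hatw ** _)]ampM // bcompA.
  rewrite -[_ ** Phi t hatw ** _]bcompA -(ampM hatw) // amp_what_range // bcompA.
  by rewrite hatw_isometry bcomp1l.
Unshelve. all: by end_near. Qed.

End AdaptedCocycle.

(** * Equivalence of Beurling type and exact adapted cocycles *)

Theorem theorem2p3 (R : realType) (H K L : hilbertType R)
    (sepH : separable H) (sepK : separable K) (T : hilbert_tensor H K L)
    (delta : H) (delta_unit : `|delta| = 1)
    (alpha : R -> bop L L -> bop L L) (alphaE0 : E0_semigroup alpha)
    (gamma : R -> bop K K -> bop K K) (gammaE0 : E0_semigroup gamma) :
  (beurling_type T alpha /\
   forall t y, 0 <= t -> tensop T (bid H) (gamma t y) = alpha t (tensop T (bid H) y))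
  <->
  (exists u : R -> bop L L,
    [/\ cocycle (fun t => amplification T (gamma t)) u,
        adapted T gamma u,
        exact_cocycle T delta gamma u &
        forall t x, 0 <= t ->
          alpha t x = u t ** amplification T (gamma t) x ** adj (u t)]).
Proof.
have d1 := slice_delta T delta_unit.
split=> [[[_ [gamma' [_ det' [w [w_unitary conj']]]]] det]|].
  (* Beurling type comes with its own semigroup [gamma']; compressing 1 (x) z by [slice T delta]
     recovers z and identifies it with [gamma]. *)
  have gammaE t y : 0 <= t -> gamma' t y = gamma t y.
    move=> t0; have tE := etrans (det' t y t0) (esym (det t y t0)).
    have slE (z : bop K K) :
        adj (slice T delta) ** (tensop T (bid H) z ** slice T delta) = z.
      by rewrite tensop_slice // bcompA d1 bcomp1l.
    by rewrite -[LHS]slE tE slE.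
  have [w1 w2] := w_unitary.
  have s_unitary : unitary (adj w) by split; rewrite adjK.
  have alphaE t x : 0 <= t ->
      alpha t x = adj (adj w) ** gamma t (adj w ** x ** adj (adj w)) ** adj w.
    move=> t0; rewrite !adjK -gammaE // conj' //.
    have -> : w ** (adj w ** x ** w) ** adj w = (w ** adj w) ** x ** (w ** adj w).
      by rewrite !bcompA.
    by rewrite w2 bcomp1 bcomp1l !bcompA w2 bcomp1l -bcompA w2 bcomp1.
  pose u t := adj (slice T delta ** adj w) **
    amplification T (gamma t) (slice T delta ** adj w).
  have alpha_u t x : 0 <= t ->
      alpha t x = u t ** amplification T (gamma t) x ** adj (u t).
    by move=> t0; rewrite alphaE //; exact: cocycle_conj.
  exists u; split=> //.
  - exact: amplification_cocycle.
  (* 1 (x) gamma_t y is both Phi_t (1 (x) y) and alpha_t (1 (x) y), and [u t] intertwines these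
     two. *)
  - move=> t y t0; have [_ _ PT] := ampP T sepH sepK gammaE0 s_unitary t0.
    have [u1 _] := cocycle_unitary T sepH sepK delta_unit gammaE0 s_unitary t0.
    by rewrite [in RHS]det // alpha_u // -[RHS]bcompA u1 bcomp1 PT.
  - exists (slice T delta ** adj w); split=> //.
      exact: hatw_isometry.
    by rewrite hatw_range // tensop_ketbra.
move=> [u [_ u_adapted [hatw [hatw1 hatw2 uE]] alpha_u]].
rewrite tensop_ketbra // bcomp1 in hatw2.
pose s := adj (slice T delta) ** hatw.
(* [hatw] is unchanged by its range projection [slice T delta ** adj (slice T delta)], hence factors
   through [slice T delta]. *)
have hatwE : hatw = slice T delta ** s.
  by rewrite /s bcompA -hatw2 -bcompA hatw1 bcomp1.
have s_unitary : unitary s.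
  split; rewrite /s adjM adjK bcompA.
    rewrite -[_ ** slice T delta ** _]bcompA -hatw2.
    by rewrite -!bcompA hatw1 bcomp1 hatw1.
  by rewrite -[_ ** hatw ** _]bcompA hatw2 !bcompA d1 bcomp1l d1.
clearbody s.
have uE' t : 0 <= t -> u t = adj (slice T delta ** s) **
    amplification T (gamma t) (slice T delta ** s).
  by move=> t0; rewrite uE // hatwE.
(* By adaptedness, 1 (x) gamma_t y can be pulled to the left of [u t], which then cancels against
   its adjoint. *)
have det t y : 0 <= t ->
    tensop T (bid H) (gamma t y) = alpha t (tensop T (bid H) y).
  move=> t0; have [_ _ PT] := ampP T sepH sepK gammaE0 s_unitary t0.
  have [_ u2] := cocycle_unitary T sepH sepK delta_unit gammaE0 s_unitary t0.
  rewrite alpha_u // PT u_adapted // -bcompA uE' // u2 bcomp1 //.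
split=> //; split=> [t y t0|].
  by exists (gamma t y); rewrite det.
(* The unitary [adj s] from [K] to [L] conjugates [gamma] to [alpha], by inverting
   [cocycle_conj]. *)
exists gamma; split=> //; exists (adj s); split.
  by have [s1 s2] := s_unitary; split; rewrite adjK.
move=> t y t0; rewrite adjK alpha_u // uE' // -cocycle_conj //.
have [s1 s2] := s_unitary.
have -> : s ** (adj s ** y ** s) ** adj s = (s ** adj s) ** y ** (s ** adj s).
  by rewrite !bcompA.
rewrite s2 bcomp1 bcomp1l !bcompA s2 bcomp1l -bcompA s2 bcomp1 //.
Qed.
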